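(* There exists a PTAS for the maximum-cardinality triangle-free 2-matching problem: for every fixed $\varepsilon\in(0,1]$ there is an algorithm which, given an undirected graph $G=(V,E)$, runs in time polynomial in $|V|$ (for fixed $\varepsilon$) and outputs a triangle-free 2-matching $M$ of $G$ with $|M|\geq(1-\varepsilon)|M^*|$, where $M^*$ is a maximum-cardinality triangle-free 2-matching of $G$.
   Context: Let $G=(V,E)$ be an undirected graph. A (simple) 2-matching is a set $M\subseteq E$ such that every node of $V$ is incident to at most two edges of $M$. A 2-matching $M$ is triangle-free if the graph $(V,M)$ contains no triangle (cycle of length 3). The triangle-free 2-matching problem asks for a triangle-free 2-matching of maximum cardinality. *)

(* Defs.v *)
From mathcomp Require Import all_boot.

Set Implicit Arguments.
Unset Strict Implicit.
Unset Printing Implicit Defensive.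

(* A simple undirected graph on V is given by its edge set: a set of
   two-element sets of nodes. *)
Definition simple_graph (V : finType) (E : {set {set V}}) : bool :=
  [forall e in E, #|e| == 2].

Definition two_matching (V : finType) (E M : {set {set V}}) : bool :=
  (M \subset E) && [forall v : V, #|[set e in M | v \in e]| <= 2].

Definition has_triangle (V : finType) (M : {set {set V}}) : bool :=
  [exists x : V, exists y : V, exists z : V,
    [&& x != y, y != z, x != z,
        [set x; y] \in M, [set y; z] \in M & [set x; z] \in M]].

Definition tf2_matching (V : finType) (E M : {set {set V}}) : bool :=
  two_matching E M && ~~ has_triangle M.

Definition max_tf2_matching (V : finType) (E M : {set {set V}}) : Prop :=
  tf2_matching E M /\ forall N, tf2_matching E N -> #|N| <= #|M|.

(* The machine model is the random access machine with unbounded cells,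
   addition, truncated subtraction and indirect addressing, under the
   unit-cost measure, programmed with structured control.  A program only
   mentions finitely many registers; unbounded storage is the memory, reached
   through [Read] and [Write].  Multiplication is deliberately not primitive:
   without it, each step lengthens the largest number present by at most one
   bit, so that polynomial time here is polynomial time on Turing machines. *)
Record state := State { reg : nat -> nat; mem : nat -> nat }.

Definition upd (f : nat -> nat) (a v : nat) : nat -> nat :=
  fun b => if b == a then v else f b.

Definition set_reg (s : state) (x v : nat) : state :=
  State (upd (reg s) x v) (mem s).

Definition set_mem (s : state) (a v : nat) : state :=
  State (reg s) (upd (mem s) a v).

Inductive prog : Type :=
| Skip
| Const (x c : nat)         (* x := c *)
| Add (x y z : nat)         (* x := y + z *)
| Sub (x y z : nat)         (* x := y - z, truncated at 0 *)
| Read (x y : nat)          (* x := mem[y] *)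
| Write (x y : nat)         (* mem[x] := y *)
| Seq (p q : prog)
| If (x : nat) (p q : prog) (* the test is x <> 0 *)
| While (x : nat) (p : prog).

(* [exec p s s' t]: started in state s, the program p halts in state s' after
   exactly t steps, each instruction and each evaluation of a test being one
   step. *)
Inductive exec : prog -> state -> state -> nat -> Prop :=
| exec_Skip s : exec Skip s s 1
| exec_Const s x c : exec (Const x c) s (set_reg s x c) 1
| exec_Add s x y z : exec (Add x y z) s (set_reg s x (reg s y + reg s z)) 1
| exec_Sub s x y z : exec (Sub x y z) s (set_reg s x (reg s y - reg s z)) 1
| exec_Read s x y : exec (Read x y) s (set_reg s x (mem s (reg s y))) 1
| exec_Write s x y : exec (Write x y) s (set_mem s (reg s x) (reg s y)) 1
| exec_Seq p q s1 s2 s3 t1 t2 :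
    exec p s1 s2 t1 -> exec q s2 s3 t2 -> exec (Seq p q) s1 s3 (t1 + t2)
| exec_IfT x p q s s' t :
    reg s x != 0 -> exec p s s' t -> exec (If x p q) s s' t.+1
| exec_IfF x p q s s' t :
    reg s x = 0 -> exec q s s' t -> exec (If x p q) s s' t.+1
| exec_WhileF x p s :
    reg s x = 0 -> exec (While x p) s s 1
| exec_WhileT x p s1 s2 s3 t1 t2 :
    reg s1 x != 0 -> exec p s1 s2 t1 -> exec (While x p) s2 s3 t2 ->
    exec (While x p) s1 s3 (t1 + t2).+1.

(* A graph with n nodes is presented with its nodes numbered from 0: register
   0 holds n, cells 0, ..., n * n - 1 hold the adjacency matrix in row-major
   order, everything else is 0. *)
Definition input_state (n : nat) (E : {set {set 'I_n}}) : state :=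
  State (fun x => if x == 0 then n else 0)
        (fun a => [exists i : 'I_n, exists j : 'I_n,
                     (a == i * n + j) && ([set i; j] \in E)] : nat).

(* The same adjacency-matrix format is used to read off the output; registers
   and the remaining cells are irrelevant then. *)
Definition outputs (n : nat) (s : state) (M : {set {set 'I_n}}) : Prop :=
  forall i j : 'I_n, mem s (i * n + j) = ([set i; j] \in M : nat).

(* Main.v *)
(** Local search: starting from the empty set, keep applying any exchange of at
    most [2k] edges that gives a larger triangle-free 2-matching, where
    [k >= 1/eps].  The point is that a solution [A] admitting no such exchange
    satisfies [k |O| <= k |A| + |O|] for an optimum [O].

    Choose the optimum [O] sharing as many edges with [A] as possible, and call
    the edges of [O \ A] blue and those of [A \ O] red.  At every node, match
    blue edges with red ones as far as possible.  Every edge has at most one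
    partner at each end, so the components of the partnership relation are
    alternating paths and cycles, on which the blue edges outnumber the red ones
    by at most one.  Exchanging a whole component respects the degree bounds,
    and it creates no triangle provided that every triangle with both colours
    has two partners among its edges.  A shortest component with a surplus of
    blue edges has then at most [(|A| + |O|) / (|O| - |A|)] edges.

    The matchings are found by serving each bichromatic triangle at one of its
    corners.  Two triangles compete at a corner only if they share an edge; the
    choice of [O] excludes the configurations in which competition propagates
    (a 2-opt move on [O], reversing a segment of length at most 2, would bring
    it closer to [A]), and what remains is settled by a tie-breaking rule. *)

Require Import Defs.
From HB Require Import structures.
From mathcomp Require Import all_boot all_order all_algebra.
From mathcomp Require Import reals.
From mathcomp Require Import zify.

Set Implicit Arguments.
Unset Strict Implicit.
Unset Printing Implicit Defensive.

(** * Corners of bichromatic triangles *)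

Section Corners.
Variable V : finType.
Implicit Types (a o : rel V) (v p q x y z : V).

(* With [a] the current solution and [o] the optimum, [only o a] is the blue
   colour and [only a o] the red one. *)
Definition only a o : rel V := fun x y => a x y && ~~ o x y.

(* The corner at [v] of a triangle [v p q] whose side [v p] is blue and whose
   side [v q] is red. *)
Definition corner a o v p q := [&& only o a v p, only a o v q & a p q || o p q].

(* No other corner at [v] has exactly one of its two edges in common with this
   one, so that the pair can be matched without harming another triangle. *)
Definition free_corner a o v p q :=
  corner a o v p q &&
  [forall p', forall q', corner a o v p' q' ==> ((p' == p) == (q' == q))].

(* A triangle without common edge has a second bichromatic corner: [p] if the
   third side is red, [q] if it is blue. *)
Definition elsewhere_free a o v p q :=
  (only a o p q && free_corner a o p v q) || (only o a p q && free_corner a o q p v).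

Definition before x y := enum_rank x < enum_rank y.

(* The tie-break for a blue chord [v p] of a red 4-cycle [v q p q']: the triangles
   on [q] and [q'] are both bichromatic exactly at [v] and [p], and this rule
   gives one of the two corners to each of them. *)
Definition yields a o v p q :=
  [exists q', [&& q' != q, only a o v q', only a o p q', only a o p q
                & before v p != before q q']].

(* The last conjunct is the tie-break with the colours exchanged. *)
Definition wanted a o v p q :=
  [&& corner a o v p q, free_corner a o v p q || ~~ elsewhere_free a o v p q,
      ~~ yields a o v p q & ~~ yields o a v q p].

Definition deg2 (g : rel V) := forall v x y z,
  g v x -> g v y -> g v z -> [|| x == y, y == z | x == z].

(* [irr_K4]: no complete graph on four nodes is split into a blue and a red path.
   [irr_odet], [irr_adet]: no path [w v p s] of one colour has its ends joined
   by a path [s v t p w] of the other colour.  In each case a 2-opt move on [o]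
   trades two blue edges for two red ones. *)
Record irreducible a o : Prop := Irreducible {
  irr_asym : symmetric a;
  irr_osym : symmetric o;
  irr_aI : irreflexive a;
  irr_oI : irreflexive o;
  irr_adeg : deg2 a;
  irr_odeg : deg2 o;
  irr_K4 : forall x y z t,
    only o a x z -> only o a z t -> only o a t y ->
    only a o z y -> only a o y x -> only a o x t -> False;
  irr_odet : forall w v p s t,
    only o a w v -> only o a v p -> only o a p s ->
    only a o s v -> only a o v t -> only a o t p -> only a o p w -> False;
  irr_adet : forall w v p s t,
    only a o w v -> only a o v p -> only a o p s ->
    only o a s v -> only o a v t -> only o a t p -> only o a p w -> False }.

Lemma only_sym a o : symmetric a -> symmetric o -> symmetric (only a o).
Proof. by move=> sa so x y; rewrite /only sa so. Qed.

(** The complement of a three-edge path in a complete graph on four nodes is again such a path, and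
    the two five-node conditions trade places. *)
Lemma irreducible_swap a o : irreducible a o -> irreducible o a.
Proof.
case=> sa so aI oI da do_ k4 od ad; split=> // x y z t h1 h2 h3 h4 h5 h6.
have sr := only_sym sa so; have sb := only_sym so sa.
by apply: (k4 z t y x) => //; rewrite 1?sr 1?sb.
Qed.

Lemma corner_swap a o v p q :
  symmetric a -> symmetric o -> corner o a v q p = corner a o v p q.
Proof. by move=> sa so; rewrite /corner sa so orbC andbCA. Qed.

Lemma free_swap a o v p q :
  symmetric a -> symmetric o -> free_corner o a v q p = free_corner a o v p q.
Proof.
move=> sa so; rewrite /free_corner corner_swap //; congr (_ && _).
apply/forallP/forallP=> h x; apply/forallP=> y; have /forallP/(_ x) := h y;
  by rewrite corner_swap // eq_sym.
Qed.

Lemma elsewhere_free_swap a o v p q : symmetric a -> symmetric o ->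
  elsewhere_free o a v q p = elsewhere_free a o v p q.
Proof.
move=> sa so; rewrite /elsewhere_free orbC !(free_swap _ _ _ sa so).
by rewrite (only_sym sa so q p) (only_sym so sa q p).
Qed.

Lemma wanted_swap a o v p q : symmetric a -> symmetric o ->
  wanted o a v q p = wanted a o v p q.
Proof.
move=> sa so; rewrite /wanted corner_swap // free_swap // elsewhere_free_swap //.
by rewrite [~~ yields o a _ _ _ && _]andbC.
Qed.

Lemma free_cornerP a o v p q p' q' : free_corner a o v p q -> corner a o v p' q' ->
  (p' == p) = (q' == q).
Proof. by move=> /andP[_ /forallP/(_ p')/forallP/(_ q')/implyP] h /h /eqP. Qed.

(** A competing corner at [p] uses the blue edge to [v] or to [q'], the only neighbours of [p] in
    [o]. If it consists of [q'] and [q], the degree bound forces [q q'] to be blue, against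
    [irr_K4]; if it consists of [v] and another red edge [p q0], then [v q0] must be blue, against
    [irr_odet]. *)
Lemma conflict_free a o v p q q' : irreducible a o ->
  corner a o v p q -> corner a o v p q' -> q != q' ->
  only a o p q -> o p q' -> free_corner a o p v q.
Proof.
move=> irr /and3P[bvp rvq _] /and3P[_ rvq' _] nq rpq opq'.
have [sa so aI oI da do_ k4 od _] := irr.
have sr := only_sym sa so; have sb := only_sym so sa.
have [/andP[ovp avp] /andP[avq ovq]] := (bvp, rvq).
have [/andP[avq' ovq'] /andP[apq opq]] := (rvq', rpq).
rewrite /free_corner /corner sb bvp rpq avq /=.
apply/forallP=> p'; apply/forallP=> q0; apply/implyP=> /and3P[bpp' rpq0 g].
have [/andP[opp' app'] /andP[apq0 opq0]] := (bpp', rpq0).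
have p'E : (p' == v) || (p' == q').
  have := do_ p v q' p'; rewrite so ovp => /(_ isT opq' opp').
  by case/or3P=> /eqP e; [rewrite e aI in avq' | rewrite e eqxx orbT | rewrite e eqxx].
apply/eqP; case: eqP => [e|ne]; last first.
  rewrite (negPf (introN eqP ne)) /= in p'E; move/eqP: p'E => e.
  subst p'; apply/esym/negP=> /eqP e; subst q0.
  have naq : ~~ a q' q.
    apply/negP=> h; have := da q v p q'.
    rewrite sa avq sa apq sa h => /(_ isT isT isT) /or3P[] /eqP e.
    - by subst v; rewrite oI in ovp.
    - by subst q'; rewrite oI in opq'.
    - by subst q'; rewrite aI in avq'.
  have bqq : only o a q' q by rewrite /only naq andbT; rewrite (negPf naq) /= in g.
  by apply: (k4 v q p q') => //; rewrite sr.
subst p'; apply/esym/negPn/negP=> nq0.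
have nav : ~~ a v q0.
  apply/negP=> h; have := da v q q' q0 avq avq' h.
  by rewrite (negPf nq) [q == q0]eq_sym (negPf nq0) orbF /= => /eqP e; subst q0; rewrite opq' in opq0.
have napq' : ~~ a p q'.
  apply/negP=> h; have := da p q q' q0 apq h apq0.
  by rewrite (negPf nq) [q == q0]eq_sym (negPf nq0) orbF /= => /eqP e; subst q0; rewrite opq' in opq0.
have bvq0 : only o a v q0 by rewrite /only nav andbT; rewrite (negPf nav) /= in g.
apply: (od q0 v p q' q) => //; try by rewrite 1?sb 1?sr.
by rewrite /only opq' napq'.
Qed.

(** If both third sides were in [o], node [p] would have three neighbours there. If exactly one is,
    [conflict_free] applies to the triangle whose third side is red. *)
Lemma conflictP a o v p q q' : irreducible a o ->
  corner a o v p q -> corner a o v p q' -> q != q' ->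
  [\/ only a o p q && only a o p q', only a o p q && free_corner a o p v q
    | only a o p q' && free_corner a o p v q'].
Proof.
move=> irr c1 c2 nq.
have [/and3P[bvp rvq g] /and3P[_ rvq' g']] := (c1, c2).
have so := irr_osym irr.
case opq: (o p q); case opq': (o p q').
- have /andP[ovp _] := bvp.
  have := irr_odeg irr (v := p) (x := v) (y := q) (z := q').
  rewrite so ovp => /(_ isT opq opq'); rewrite (negPf nq) /= => /orP[] /eqP e; subst v.
    by case/andP: rvq; rewrite (irr_aI irr).
  by case/andP: rvq'; rewrite (irr_aI irr).
- have rpq' : only a o p q' by rewrite /only opq' andbT; rewrite opq' orbF in g'.
  constructor 3; rewrite rpq' /=; apply: conflict_free c2 c1 _ _ opq => //.
  by rewrite eq_sym.
- have rpq : only a o p q by rewrite /only opq andbT; rewrite opq orbF in g.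
  by constructor 2; rewrite rpq /=; apply: conflict_free c1 c2 nq _ opq'.
- rewrite opq orbF in g; rewrite opq' orbF in g'.
  by constructor 1; rewrite /only opq opq' g g'.
Qed.

Lemma before_neq x y : x != y -> before x y = ~~ before y x.
Proof.
move=> nxy; rewrite /before -leqNgt ltn_neqAle.
by rewrite (inj_eq val_inj) (inj_eq enum_rank_inj) nxy.
Qed.

(** Each of the two corners prevents the other from being free, so neither triangle has a free
    corner elsewhere, and [conflictP] leaves a red 4-cycle with chord [v p]. There [before] makes
    exactly one of the two yield. *)
Lemma wanted_uniq a o v p q q' : irreducible a o ->
  wanted a o v p q -> wanted a o v p q' -> q = q'.
Proof.
move=> irr w1 w2; apply/eqP/negPn/negP=> nq.
have [/and4P[c1 f1 y1 _] /and4P[c2 f2 y2 _]] := (w1, w2).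
have nf x y : corner a o v p x -> x != y -> free_corner a o v p y -> False.
  by move=> c ne /free_cornerP/(_ c); rewrite eqxx (negPf ne).
have e1 : ~~ elsewhere_free a o v p q.
  by case/orP: f1 => // /nf-/(_ _ c2); rewrite eq_sym nq => /(_ isT).
have e2 : ~~ elsewhere_free a o v p q'.
  by case/orP: f2 => // /nf-/(_ _ c1 nq).
case: (conflictP irr c1 c2 nq); last 2 first.
- by move=> h; rewrite /elsewhere_free h in e1.
- by move=> h; rewrite /elsewhere_free h in e2.
case/andP=> rpq rpq'.
have [/and3P[_ rvq _] /and3P[_ rvq' _]] := (c1, c2).
have := y1; rewrite negb_exists => /forallP/(_ q').
rewrite eq_sym nq rvq' rpq rpq' /= negbK => /eqP E1.
have := y2; rewrite negb_exists => /forallP/(_ q).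
rewrite nq rvq rpq rpq' /= negbK => /eqP E2.
by move: (before_neq nq); rewrite -E1 -E2; case: (before v p).
Qed.

(** A free corner never yields, because the witness would compete with it. If neither corner is
    free, each is wanted unless it yields; both cannot yield, since the degree bound gives them the
    same fourth node and the two comparisons then contradict each other. *)
Lemma wanted_red a o v p q : irreducible a o -> corner a o v p q ->
  only a o p q -> wanted a o v p q || wanted a o p v q.
Proof.
move=> irr c rpq; have [sa so aI oI da do_ _ _ _] := irr.
have sr := only_sym sa so; have sb := only_sym so sa.
have [/and3P[bvp rvq g]] := c.
have c' : corner a o p v q.
  by rewrite /corner sb bvp rpq; case/andP: rvq => ->.
have nb x y x' : only a o y x -> yields o a x' x y = false.
  move=> h; apply/existsP=> -[z /and5P[_ _ _ /andP[h1 h2] _]].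
  by rewrite so in h1; case/andP: h => _; rewrite h1.
have nbr x y : only a o x y -> only o a x y = false.
  by case/andP=> h1 h2; rewrite /only h1 andbF.
have fy x y : free_corner a o x y q -> only a o y q -> yields a o x y q = false.
  move=> f ryq; apply/existsP=> -[z /and5P[nz rz rz' _ _]].
  have cc : corner a o x y z.
    by case/andP: f => /and3P[bxy _ _] _; rewrite /corner bxy rz; case/andP: rz' => ->.
  by have := free_cornerP f cc; rewrite eqxx (negPf nz).
rewrite /wanted c c' !nb //= !andbT.
case fv: (free_corner a o v p q); first by rewrite fy.
case fp: (free_corner a o p v q); first by rewrite (fy p v) // orbT.
rewrite /elsewhere_free rpq rvq fv fp !nbr //= -negb_and; apply/negP.
case/andP=> /existsP[x /and5P[nx rvx rpx _ h1]] /existsP[y /and5P[ny rpy rvy _ h2]].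
have exy : x = y.
  have [/andP[h _] /andP[h' _] /andP[h'' _]] := And3 rvq rvx rvy.
  have := da v q x y h h' h''.
  by rewrite [q == x]eq_sym (negPf nx) [q == y]eq_sym (negPf ny) orbF => /eqP.
have nvp : v != p by apply/eqP=> e; subst p; case/andP: bvp; rewrite oI.
subst y; move: h1 h2; by rewrite (before_neq nvp); case: (before p v); case: (before q x).
Qed.

(** This is the service guarantee for bichromatic triangles. A common third side excludes both
    [elsewhere_free] and [yields]; otherwise [wanted_red] applies, with the colours exchanged if
    that side is blue. *)
Lemma corner_wanted a o v p q : irreducible a o -> corner a o v p q ->
  [|| wanted a o v p q, only a o p q && wanted a o p v q
    | only o a p q && wanted a o q p v].
Proof.
move=> irr c; have [sa so _ _ _ _ _ _ _] := irr.
case rpq: (only a o p q).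
  by have /orP[->|->] := wanted_red irr c rpq; rewrite ?orbT.
case bpq: (only o a p q) => /=; last first.
  rewrite orbF /wanted c /= /elsewhere_free rpq bpq orbT /= -negb_or; apply/negP.
  case/orP=> /existsP[x /and5P[_ _ _ h _]]; first by rewrite h in rpq.
  by rewrite (only_sym so sa) bpq in h.
have c' : corner o a v q p by rewrite corner_swap.
have bqp : only o a q p by rewrite (only_sym so sa).
have := wanted_red (irreducible_swap irr) c' bqp.
by rewrite !(wanted_swap _ _ _ sa so) => /orP[] ->; rewrite ?orbT.
Qed.

End Corners.

Definition symd (T : finType) (X Y : {set T}) := (X :\: Y) :|: (Y :\: X).

(** * Exchanging a union of components *)

(** In a complete bipartite graph a maximal matching saturates one side, since two unmatched
    elements could still be paired. *)
Lemma extend_matching (T : finType) (B R : {set T}) (W : {set T * T}) :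
  W \subset setX B R -> {in W &, forall x y, (x.1 == y.1) = (x.2 == y.2)} ->
  exists P : {set T * T},
    [/\ W \subset P, P \subset setX B R,
        {in P &, forall x y, (x.1 == y.1) = (x.2 == y.2)}
      & B \subset [set x.1 | x in P] \/ R \subset [set x.2 | x in P]].
Proof.
move=> WBR Wm.
pose ok (P : {set T * T}) := (P \subset setX B R) &&
  [forall x in P, forall y in P, (x.1 == y.1) == (x.2 == y.2)].
have okW : ok W.
  rewrite /ok WBR; apply/forall_inP=> x xW; apply/forall_inP=> y yW.
  by rewrite Wm.
have [P /maxsetP[/andP[PBR /forall_inP Pm] Pmax] WP] := maxset_exists okW.
have Pm' : {in P &, forall x y, (x.1 == y.1) = (x.2 == y.2)}.
  by move=> x y xP yP; have /forall_inP h := Pm x xP; rewrite (eqP (h y yP)).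
exists P; split=> //.
case: (boolP (B \subset _)) => [|/subsetPn[p pB pP]]; first by left.
right; apply/subsetP=> q qR; apply/negPn/negP=> qP.
have nx x : x \in P -> ((x.1 == p) = false) * ((x.2 == q) = false).
  move=> xP; split; apply/eqP=> e.
    by case/negP: pP; rewrite -e; apply/imsetP; exists x.
  by case/negP: qP; rewrite -e; apply/imsetP; exists x.
have : (p, q) \in P.
  rewrite -(Pmax ((p, q) |: P)) ?subsetUr ?setU11 //.
  apply/andP; split.
    by rewrite subUset PBR sub1set inE pB qR.
  apply/forall_inP=> x /setU1P[->|xP]; apply/forall_inP=> y /setU1P[->|yP] /=;
    by rewrite ?eqxx ?Pm' // ?nx // 1?[p == _]eq_sym 1?[q == _]eq_sym ?nx.
by move/nx=> [/= /eqP].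
Qed.

(** A spanning tree has one link fewer than nodes; it is grown here as a largest [S] with enough
    internal links. Links are labels, so that parallel ones stay distinct. *)
Lemma connected_card (T I : finType) (L : {set I}) (src dst : I -> T)
    (e : rel T) (x0 : T) :
  (forall x y, e x y -> exists2 l, l \in L &
     src l = x /\ dst l = y \/ src l = y /\ dst l = x) ->
  #|[set y | connect e x0 y]|
    <= #|[set l in L | connect e x0 (src l) && connect e x0 (dst l)]|.+1.
Proof.
move=> eP; set K := [set y | _].
pose lk (S : {set T}) := [set l in L | (src l \in S) && (dst l \in S)].
pose ok (S : {set T}) := [&& x0 \in S, S \subset K & #|S| <= #|lk S|.+1].
have ok0 : ok [set x0].
  by rewrite /ok set11 cards1 sub1set inE connect0.
case: (arg_maxnP (fun S : {set T} => #|S|) ok0) => S /and3P[x0S SK Scard] Smax.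
suff KS : K \subset S.
  apply: leq_trans (subset_leq_card KS) _; apply: leq_trans Scard _.
  rewrite ltnS; apply: subset_leq_card; apply/subsetP=> l; rewrite !inE.
  by case/and3P=> -> /(subsetP SK); rewrite inE => -> /(subsetP SK); rewrite inE.
case: (boolP [exists x in S, exists y, (y \notin S) && e x y]) => [|nex].
  case/exists_inP=> x xS /existsP[y /andP[yS exy]].
  have /Smax : ok (y |: S).
    apply/and3P; split; first by rewrite inE x0S orbT.
      rewrite subUset SK sub1set inE andbT.
      apply: connect_trans (connect1 exy).
      by move/subsetP: SK => /(_ x xS); rewrite inE.
    have [l lL ends] := eP _ _ exy.
    rewrite cardsU1 yS add1n ltnS; apply: leq_trans Scard _.
    apply: proper_card; apply/properP; split.
      apply/subsetP=> m; rewrite !inE => /and3P[-> -> ->].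
      by rewrite !orbT.
    exists l; rewrite !inE lL; case: ends => -[-> ->];
      by rewrite ?eqxx ?xS ?orbT ?(negPf yS) ?andbF.
  by rewrite /= cardsU1 yS add1n ltnn.
apply/subsetP=> y; rewrite inE => /connectP[p].
elim: p x0 x0S {ok0 Smax ok Scard SK K} => [x xS _ -> //|z p IH x xS /= /andP[exz pp] ly].
apply: IH pp ly; apply/negPn/negP=> zS; case/negP: nex.
by apply/exists_inP; exists x => //; apply/existsP; exists z; rewrite zS.
Qed.

(** * Degrees and triangles of edge sets *)

Lemma card_le2P (T : finType) (S : {set T}) :
  reflect (forall x y z, x \in S -> y \in S -> z \in S -> [|| x == y, y == z | x == z])
    (#|S| <= 2).
Proof.
rewrite leqNgt; apply: (iffP idP) => [h x y z xS yS zS|h].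
  apply/negPn/negP; rewrite !negb_or => /and3P[xy yz xz]; case/negP: h.
  have <- : #|[set x; y; z]| = 3.
    by rewrite setUC cardsU1 cards2 xy !inE negb_or ![z == _]eq_sym xz yz.
  by apply: subset_leq_card; rewrite !subUset !sub1set xS yS zS.
apply/negP=> /card_gt2P[x [y [z [[xS yS zS] [xy yz zx]]]]].
have := h x y z xS yS zS.
by rewrite (negPf xy) (negPf yz) [x == z]eq_sym (negPf zx).
Qed.

Section Edges.
Variable V : finType.
Implicit Types (E M A O D : {set {set V}}) (v x y z p q : V).

Definition adj M : rel V := fun x y => [set x; y] \in M.

Lemma adj_sym M : symmetric (adj M).
Proof. by move=> x y; rewrite /adj setUC. Qed.

Lemma simple_sub E M : simple_graph E -> M \subset E -> simple_graph M.
Proof.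
move=> /forall_inP sE /subsetP ME; apply/forall_inP=> e eM.
by apply: sE; apply: ME.
Qed.

Lemma adj_irr M : simple_graph M -> irreflexive (adj M).
Proof.
move=> /forall_inP sM x; apply/negP=> /sM.
by rewrite setUid cards1.
Qed.

Lemma simple_edge M e v : simple_graph M -> e \in M -> v \in e ->
  exists p, e = [set v; p].
Proof.
move=> /forall_inP sM eM ve; have /cards2P[x [y [nxy ee]]] := sM e eM.
have : v \in [set x; y] by rewrite -ee.
by case/set2P=> ->; [exists y | exists x; rewrite setUC].
Qed.

Lemma set2_inj v : injective (fun p => [set v; p]).
Proof.
move=> p q e; have : p \in [set v; q] by rewrite -e !inE eqxx orbT.
rewrite !inE => /orP[] /eqP // epv.
have : q \in [set v; p] by rewrite e !inE eqxx orbT.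
by rewrite epv !inE orbb => /eqP ->.
Qed.

Lemma eq_set2 x y z p :
  ([set x; y] == [set z; p]) = (x == z) && (y == p) || (x == p) && (y == z).
Proof.
apply/eqP/orP=> [e|]; last first.
  by case=> /andP[/eqP-> /eqP->] //; rewrite setUC.
have : x \in [set z; p] by rewrite -e !inE eqxx.
rewrite !inE => /orP[] /eqP x_; subst x; rewrite eqxx /=.
  by left; apply/eqP/(set2_inj e).
by right; apply/eqP/(@set2_inj p); rewrite e setUC.
Qed.

Lemma card_incident M v : simple_graph M ->
  #|[set e in M | v \in e]| = #|[set p | adj M v p]|.
Proof.
move=> sM; rewrite -(card_imset _ (@set2_inj v)); apply: eq_card => e.
apply/idP/imsetP=> [|[p]]; rewrite !inE.
  case/andP=> eM ve; have [p ep] := simple_edge sM eM ve.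
  by exists p; rewrite // inE /adj -ep.
by move=> h ->; rewrite -/(adj M v p) h !inE eqxx.
Qed.

Lemma card_darts M : simple_graph M ->
  #|[set xy : V * V | adj M xy.1 xy.2]| = 2 * #|M|.
Proof.
move=> /forall_inP sM; rewrite -sum1_card.
rewrite (partition_big (fun xy => [set xy.1; xy.2]) (mem M)) /=; last first.
  by move=> xy; rewrite inE.
rewrite mulnC -sum_nat_const; apply: eq_bigr => e eM.
have /cards2P[x [y [nxy ee]]] := sM e eM.
rewrite sum1_card (@eq_card _ _ (mem [set (x, y); (y, x)])).
  by rewrite cards2 xpair_eqE negb_and nxy.
move=> [u w]; rewrite !inE !xpair_eqE unfold_in /= inE /=.
apply/andP/orP=> [[_ /eqP h]|].
  have : (u \in e) && (w \in e) by rewrite -h !inE !eqxx orbT.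
  have : (x \in [set u; w]) && (y \in [set u; w]) by rewrite h ee !inE !eqxx orbT.
  rewrite ee !inE => /andP[h1 h2] /andP[h3 h4].
  move: h1 h2 h3 h4; rewrite !(eq_sym x) !(eq_sym y).
  by case: (u == x); case: (u == y); case: (w == x); case: (w == y) => //= _ _ _ _; by [left|right].
case=> /andP[/eqP -> /eqP ->]; first by rewrite /adj -ee eqxx.
by rewrite /adj setUC -ee eqxx.
Qed.

Lemma two_matchingP E M : simple_graph E ->
  reflect (M \subset E /\ deg2 (adj M)) (two_matching E M).
Proof.
move=> sE; apply: (iffP andP) => -[ME h]; split=> //.
  move=> v x y z hx hy hz; have := forallP h v.
  rewrite card_incident; last exact: simple_sub ME.
  by move/card_le2P=> h2; apply: h2; rewrite inE.
apply/forallP=> v; rewrite card_incident; last exact: simple_sub ME.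
by apply/card_le2P=> x y z; rewrite !inE; apply: h.
Qed.

Lemma no_triangleP M : simple_graph M ->
  reflect (forall x y z, adj M x y -> adj M y z -> adj M x z -> False)
    (~~ has_triangle M).
Proof.
move=> sM; apply: (iffP idP) => [h x y z xy yz xz|h].
  case/negP: h; apply/existsP; exists x; apply/existsP; exists y.
  apply/existsP; exists z; rewrite /adj in xy yz xz; rewrite xy yz xz !andbT.
  have ne u w : [set u; w] \in M -> u != w.
    by move=> h; apply/eqP=> e; subst w; have := adj_irr sM u; rewrite /adj h.
  by rewrite !ne.
apply/negP=> /existsP[x /existsP[y /existsP[z /and5P[_ _ _ xy /andP[yz xz]]]]].
exact: h xy yz xz.
Qed.

End Edges.

(** * Exchanging a set of edges closed under partnership *)

Lemma card_set_sum (T : finType) (P : pred T) : #|[set x | P x]| = \sum_x P x.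
Proof.
rewrite cardsE -sum1_card big_mkcond; apply: eq_bigr => x _.
by rewrite unfold_in; case: (P x).
Qed.

Lemma leq_card_matching (T : finType) (X Y : {set T}) (g : rel T) :
  (forall x, x \in X -> exists2 y, y \in Y & g x y) ->
  (forall x x' y, g x y -> g x' y -> x = x') -> #|X| <= #|Y|.
Proof.
move=> gX ginj; pose f x := odflt x [pick y in Y | g x y].
have fP x : x \in X -> (f x \in Y) /\ g x (f x).
  move=> xX; rewrite /f; case: pickP => [y /andP[]//|h].
  by have [y yY gxy] := gX x xX; have := h y; rewrite yY gxy.
rewrite -(card_in_imset (f := f) (D := mem X)).
  by apply/subset_leq_card/subsetP=> _ /imsetP[x /fP[fY _] ->].
move=> x x' /fP[_ gx] /fP[_ gx'] e; apply: ginj gx _; by rewrite e.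
Qed.

Lemma in_symd (T : finType) (X Y : {set T}) x :
  (x \in symd X Y) = (x \in X) (+) (x \in Y).
Proof. by rewrite !inE; case: (x \in X); case: (x \in Y). Qed.

Section Pairing.
Variables (V : finType) (E A O : {set {set V}}).
Hypothesis sE : simple_graph E.
Hypothesis tA : tf2_matching E A.
Hypothesis tO : tf2_matching E O.
Let a := adj A.
Let o := adj O.
Hypothesis irr : irreducible a o.

(** A pair of neighbours stands for the two edges joining them to [v]. The first clause will destroy
    triangles, the last will control degrees. *)
Definition pairing_at v (P : {set V * V}) :=
  [/\ forall p q, wanted a o v p q -> (p, q) \in P,
      forall p q, (p, q) \in P -> only o a v p && only a o v q,
      {in P &, forall x y, (x.1 == y.1) = (x.2 == y.2)}
    & (forall p, only o a v p -> exists q, (p, q) \in P) \/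
      (forall q, only a o v q -> exists p, (p, q) \in P)].

(** By [wanted_uniq], used for both orders of the colours, the wanted corners at a node form a
    matching, which [extend_matching] completes. *)
Lemma pairing_exists : exists P, forall v, pairing_at v (P v).
Proof.
apply: fin_all_exists => v.
pose B := [set p | only o a v p]; pose R := [set q | only a o v q].
pose W := [set x | wanted a o v x.1 x.2].
have [sa so _ _ _ _ _ _ _] := irr.
have WBR : W \subset setX B R.
  by apply/subsetP=> x; rewrite !inE => /and4P[/and3P[-> ->]].
have Wm : {in W &, forall x y, (x.1 == y.1) = (x.2 == y.2)}.
  move=> [p q] [p' q']; rewrite !inE /= => w w'.
  apply/eqP/eqP=> e; subst.
    exact: wanted_uniq irr w w'.
  apply: (wanted_uniq (irreducible_swap irr) (v := v) (p := q')).
    by rewrite wanted_swap.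
  by rewrite wanted_swap.
have [P [WP PBR Pm Pc]] := extend_matching WBR Wm.
exists P; split=> //.
- by move=> p q w; apply: (subsetP WP); rewrite inE.
- by move=> p q /(subsetP PBR); rewrite !inE.
- case: Pc => h; [left=> p hp|right=> q hq].
    have : p \in B by rewrite inE.
    by move/(subsetP h)=> /imsetP[[x y] xP /= ->]; exists y.
  have : q \in R by rewrite inE.
  by move/(subsetP h)=> /imsetP[[x y] xP /= ->]; exists x.
Qed.

Variable P : V -> {set V * V}.
Hypothesis PP : forall v, pairing_at v (P v).

Definition closed_under (D : {set {set V}}) :=
  forall v p q, (p, q) \in P v -> ([set v; p] \in D) = ([set v; q] \in D).

Variable D : {set {set V}}.
Hypothesis DAO : D \subset symd A O.
Hypothesis Dc : closed_under D.

Lemma adj_symd x y : adj (symd A D) x y = a x y (+) ([set x; y] \in D).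
Proof. by rewrite /adj in_symd. Qed.

Lemma sub_symd x y : [set x; y] \in D -> a x y (+) o x y.
Proof. by move/(subsetP DAO); rewrite in_symd. Qed.

(** If all blue edges at [v] have partners, the blue edges entering are at most as many as the red
    ones leaving, and the degree in [A] bounds the new one. If all red edges have partners, the red
    edges that stay are at most as many as the blue ones left out, and the degree in [O] does. *)
Lemma symd_deg2 : deg2 (adj (symd A D)).
Proof.
move=> v; move: {-2}v (erefl v) => v0 ev.
have [AE da] := two_matchingP A sE (proj1 (andP tA)).
have [OE do_] := two_matchingP O sE (proj1 (andP tO)).
suff /card_le2P h : #|[set p | adj (symd A D) v0 p]| <= 2.
  by move=> x y z hx hy hz; apply: h; rewrite inE.
subst v0; have [_ Pbr Pm Pc] := PP v.
pose X (c : rel V) (b : bool) := [set p | c v p && (([set v; p] \in D) == b)].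
pose C := [set p | a v p && o v p].
have eN : #|[set p | adj (symd A D) v p]|
    = #|C| + #|X (only a o) false| + #|X (only o a) true|.
  rewrite !card_set_sum -!big_split; apply: eq_bigr => p _ /=.
  rewrite adj_symd /only; have := @sub_symd v p.
  by case: (_ \in D) => [/(_ isT)|_]; case: (a v p); case: (o v p).
have eA : #|[set p | a v p]|
    = #|C| + #|X (only a o) false| + #|X (only a o) true|.
  rewrite !card_set_sum -!big_split; apply: eq_bigr => p _ /=.
  by rewrite /only; case: (_ \in D); case: (a v p); case: (o v p).
have eO : #|[set p | o v p]|
    = #|C| + #|X (only o a) false| + #|X (only o a) true|.
  rewrite !card_set_sum -!big_split; apply: eq_bigr => p _ /=.
  by rewrite /only; case: (_ \in D); case: (a v p); case: (o v p).
have dA : #|[set p | a v p]| <= 2.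
  by apply/card_le2P=> x y z; rewrite !inE; apply: da.
have dO : #|[set p | o v p]| <= 2.
  by apply/card_le2P=> x y z; rewrite !inE; apply: do_.
case: Pc => Pc.
  suff : #|X (only o a) true| <= #|X (only a o) true| by lia.
  apply: (leq_card_matching (g := fun p q => (p, q) \in P v)).
    move=> p; rewrite inE => /andP[/Pc[q pq] pD]; exists q => //.
    by rewrite inE -(Dc pq) pD; case/andP: (Pbr _ _ pq) => _ ->.
  by move=> p p' q h h'; have := Pm _ _ h h'; rewrite /= eqxx => /eqP.
suff : #|X (only a o) false| <= #|X (only o a) false| by lia.
apply: (leq_card_matching (g := fun q p => (p, q) \in P v)).
  move=> q; rewrite inE => /andP[/Pc[p pq] pD]; exists p => //.
  by rewrite inE (Dc pq) pD; case/andP: (Pbr _ _ pq) => ->.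
by move=> p p' q h h'; have := Pm _ _ h h'; rewrite /= eqxx => /esym/eqP.
Qed.

Lemma symd_sub : symd A D \subset E.
Proof.
have [AE _] := two_matchingP A sE (proj1 (andP tA)).
have [OE _] := two_matchingP O sE (proj1 (andP tO)).
apply/subsetP=> e; rewrite in_symd; case eA: (e \in A) => /=.
  by move=> _; apply: (subsetP AE).
by move/(subsetP DAO); rewrite in_symd eA; apply: (subsetP OE).
Qed.

(** The two edges of a wanted corner are partners, so [D] contains both or neither, and exactly one
    of them is present after the exchange. *)
Lemma symd_corner v p q : only o a v p -> only a o v q -> a p q || o p q ->
  adj (symd A D) v p -> adj (symd A D) v q -> adj (symd A D) p q -> False.
Proof.
move=> bvp rvq g; have c : corner a o v p q by rewrite /corner bvp rvq.
have [sa so _ _ _ _ _ _ _] := irr.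
have key x y z : wanted a o x y z -> adj (symd A D) x y -> adj (symd A D) x z -> False.
  move=> w; have [/(_ y z w) xP _ _ _] := PP x.
  case/and4P: w => /and3P[/andP[_ ay] /andP[az _] _] _ _ _.
  by rewrite !adj_symd (negPf ay) az (Dc xP) /= => ->.
have sD := adj_sym (symd A D).
move=> h1 h2 h3; case/or3P: (corner_wanted irr c) => [w|/andP[_ w]|/andP[_ w]].
- exact: key w h1 h2.
- by apply: key w _ h3; rewrite sD.
- by apply: key w _ _; rewrite sD.
Qed.

(** A triangle contained neither in [A] nor in [O] has a blue and a red edge, and these meet at a
    corner. *)
Lemma symd_tf2 : tf2_matching E (symd A D).
Proof.
apply/andP; split; first by apply/two_matchingP=> //; split; [apply: symd_sub | apply: symd_deg2].
have [AE _] := two_matchingP A sE (proj1 (andP tA)).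
have [OE _] := two_matchingP O sE (proj1 (andP tO)).
have /no_triangleP -/(_ (simple_sub sE AE)) nA := proj2 (andP tA).
have /no_triangleP -/(_ (simple_sub sE OE)) nO := proj2 (andP tO).
apply/no_triangleP; first exact: simple_sub symd_sub.
move=> x y z xy yz xz; have sD := adj_sym (symd A D).
have [sa so _ _ _ _ _ _ _] := irr.
have ao u w : adj (symd A D) u w -> a u w || o u w.
  rewrite adj_symd; have := @sub_symd u w.
  by case: (_ \in D) => [/(_ isT)|_]; case: (a u w); case: (o u w).
have key u w t : adj (symd A D) u w -> adj (symd A D) u t -> adj (symd A D) w t ->
    only o a u w && only a o u t = false.
  move=> h1 h2 h3; apply/negP=> /andP[b r].
  exact: (symd_corner b r (ao _ _ h3)) h1 h2 h3.
have yx : adj (symd A D) y x by rewrite sD.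
have zy : adj (symd A D) z y by rewrite sD.
have zx : adj (symd A D) z x by rewrite sD.
have := nA x y z; have := nO x y z; rewrite -/a -/o.
have := key _ _ _ xy xz yz; have := key _ _ _ xz xy zy.
have := key _ _ _ yx yz xz; have := key _ _ _ yz yx zx.
have := key _ _ _ zx zy xy; have := key _ _ _ zy zx yx.
move: (ao _ _ xy) (ao _ _ yz) (ao _ _ xz).
rewrite /only (sa y x) (so y x) (sa z x) (so z x) (sa z y) (so z y).
case: (a x y); case: (o x y); case: (a y z); case: (o y z); case: (a x z);
  case: (o x z) => //= _ _ _ _ _ _ _ _ _ hO hA; by [apply: hA | apply: hO].
Qed.

End Pairing.

(** * Components of the partnership relation *)

Section Linked.
Variables (V : finType) (P : V -> {set V * V}).

Definition linked : rel {set V} := fun e f =>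
  [exists v, exists x in P v,
     ((e == [set v; x.1]) && (f == [set v; x.2]))
     || ((e == [set v; x.2]) && (f == [set v; x.1]))].

Lemma linked_sym : symmetric linked.
Proof.
suff h e f : linked e f -> linked f e by move=> e f; apply/idP/idP; apply: h.
case/existsP=> v /exists_inP[x xP h].
apply/existsP; exists v; apply/exists_inP; exists x => //.
by move: h; rewrite orbC ![(e == _) && _]andbC.
Qed.

Lemma linked_pair v p q : (p, q) \in P v -> linked [set v; p] [set v; q].
Proof.
move=> pq; apply/existsP; exists v; apply/exists_inP; exists (p, q) => //=.
by rewrite !eqxx.
Qed.

Lemma connect_linked_sym : connect_sym linked.
Proof. exact: sym_connect_sym linked_sym. Qed.

Lemma linked_root v p q : (p, q) \in P v ->
  fingraph.root linked [set v; p] = fingraph.root linked [set v; q].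
Proof.
move=> pq; apply/eqP; rewrite root_connect; last exact: connect_linked_sym.
exact/connect1/linked_pair.
Qed.

End Linked.

(* A component with [m] edges has at least [m - 1] partnerships, and each red edge
   is involved in at most two. *)
Lemma component_gain (V : finType) (E A O : {set {set V}}) P e0 :
  simple_graph E -> A \subset E ->
  (forall v, pairing_at A O v (P v)) ->
  #|[set e in O :\: A | connect (linked P) e0 e]|
    <= #|[set e in A :\: O | connect (linked P) e0 e]|.+1.
Proof.
move=> sE AE PP; pose K := [set e | connect (linked P) e0 e].
have KI (X : {set {set V}}) : [set e in X | connect (linked P) e0 e] = K :&: X.
  by apply/setP=> e; rewrite !inE andbC.
rewrite !KI.
pose src (l : V * (V * V)) := [set l.1; l.2.1].
pose dst (l : V * (V * V)) := [set l.1; l.2.2].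
pose L := [set l : V * (V * V) | l.2 \in P l.1].
have := @connected_card _ _ L src dst (linked P) e0.
rewrite -/K => h.
have {h} : #|K| <= #|[set l in L | connect (linked P) e0 (src l)
                           && connect (linked P) e0 (dst l)]|.+1.
  apply: h => e f /existsP[v /exists_inP[x xP]] h.
  exists (v, x); first by rewrite inE.
  by case/orP: h => /andP[/eqP -> /eqP ->]; [left|right].
set L' := [set l in L | _] => hK.
(* As partnerships form a matching, a link at [v] is determined by [v] and its red edge: links
   inject into the darts of the red edges. *)
have hL : #|L'| <= 2 * #|K :&: (A :\: O)|.
  rewrite -card_darts; last first.
    apply: simple_sub sE _; apply/subsetP=> e; rewrite !inE => /and3P[_ _].
    exact: (subsetP AE).
  rewrite -(card_in_imset (f := fun l => (l.1, l.2.2)) (D := mem L')).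
    apply/subset_leq_card/subsetP=> _ /imsetP[[v [p q]] + ->].
    rewrite !inE /= => /and3P[pP _ Kq].
    have [_ /(_ _ _ pP) /andP[_ /andP[aq oq]] _ _] := PP v.
    by rewrite /adj !inE Kq oq.
  move=> [v [p q]] [v' [p' q']]; rewrite !inE /= => /and3P[pP _ _] /and3P[pP' _ _].
  case=> e e'; subst v' q'; have [_ _ /(_ _ _ pP pP') + _] := PP v.
  by rewrite /= eqxx => /eqP ->.
have : #|K :&: (O :\: A)| + #|K :&: (A :\: O)| <= #|K|.
  rewrite -cardsUI [X in _ + X]eq_card0 ?addn0; last first.
    by move=> e; rewrite !inE; case: (e \in A); rewrite ?andbF.
  by rewrite -setIUr subset_leq_card // subsetIl.
move=> h; rewrite -(leq_add2r #|K :&: (A :\: O)|); apply: leq_trans h _.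
by apply: leq_trans hK _; rewrite addSn ltnS addnn -mul2n.
Qed.

(** * The optimum closest to the current solution *)

Section Reversal.
Variables (V : finType) (E A O : {set {set V}}).
Hypothesis sE : simple_graph E.
Hypothesis tA : tf2_matching E A.
Hypothesis tO : tf2_matching E O.
Let a := adj A.
Let o := adj O.
Hypothesis Oclosest : forall O', tf2_matching E O' -> #|O'| = #|O| ->
  #|O' :&: A| <= #|O :&: A|.

(* [x m ... n y] is a path of the optimum, [i] follows [m] and [j] precedes [n]; the
   move replaces it by [x n ... m y].  The last two hypotheses hold when the
   segment [m ... n] has length 1, and rule out new triangles otherwise. *)
Lemma no_reversal x y m n i j :
  only o a x m -> only o a n y -> only a o x n -> only a o m y ->
  o m i -> i != x -> o n j -> j != y ->
  (j == m) || ~~ o x j -> (i == n) || ~~ o y i -> False.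
Proof.
have [OE do_] := two_matchingP O sE (proj1 (andP tO)).
have [AE da] := two_matchingP A sE (proj1 (andP tA)).
have so : symmetric o := @adj_sym _ O; have sa : symmetric a := @adj_sym _ A.
have oI := adj_irr (simple_sub sE OE); have aI := adj_irr (simple_sub sE AE).
move=> bxm bny rxn rmy omi ix onj jy hj hi.
have [/andP[oxm axm] /andP[ony any_]] := (bxm, bny).
have [/andP[axn oxn] /andP[amy omy]] := (rxn, rmy).
have xm : x != m by apply/eqP=> e; subst; rewrite /o oI in oxm.
have ny : n != y by apply/eqP=> e; subst; rewrite /o oI in ony.
have xn : x != n by apply/eqP=> e; subst; rewrite /a aI in axn.
have my : m != y by apply/eqP=> e; subst; rewrite /a aI in amy.
have mn : m != n by apply/eqP=> e; subst; rewrite axn in axm.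
have xy : x != y by apply/eqP=> e; subst; rewrite so ony in oxn.
pose O1 := O :\ [set x; m] :\ [set n; y].
pose O' := [set x; n] |: ([set m; y] |: O1).
have inO' u w : adj O' u w = [|| [set u; w] == [set x; n], [set u; w] == [set m; y]
   | [&& [set u; w] != [set n; y], [set u; w] != [set x; m] & o u w]].
  by rewrite /adj !inE.
have my1 : [set m; y] \notin O1 by rewrite !inE -/(adj O m y) -/o (negPf omy) !andbF.
have xn1 : [set x; n] \notin [set m; y] |: O1.
  rewrite !inE -/(adj O x n) -/o (negPf oxn) !andbF orbF eq_set2.
  by rewrite (negPf xm) (negPf xy).
have ny1 : [set n; y] \in O :\ [set x; m].
  rewrite in_setD1 eq_set2 -/(adj O n y) -/o ony andbT.
  by rewrite !(eq_sym n) (negPf xn) (negPf mn).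
(* Three weights will be used: incidence with a node for the degrees, 1 for the cardinality,
   membership in [A] for the overlap. *)
have sum_eq (F : {set V} -> nat) : \sum_(e in O') F e + F [set n; y] + F [set x; m]
    = \sum_(e in O) F e + F [set m; y] + F [set x; n].
  rewrite /O' big_setU1 //= big_setU1 //= (big_setD1 _ oxm) /=.
  rewrite (big_setD1 _ ny1) -/O1 /=; clear; lia.
have O'E : O' \subset E.
  rewrite !subUset !sub1set (subsetP AE _ axn) (subsetP AE _ amy) /=.
  by apply: subset_trans OE; rewrite /O1; apply/subsetP=> e; rewrite !inE => /and3P[].
have deg' v : #|[set e in O' | v \in e]| <= 2.
  have := forallP (proj2 (andP (proj1 (andP tO)))) v.
  have cs (Q : {set {set V}}) : #|[set e in Q | v \in e]| = \sum_(e in Q) (v \in e).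
    rewrite -sum1_card big_mkcond [RHS]big_mkcond; apply: eq_bigr => e _.
    by rewrite !inE; case: (e \in Q); case: (v \in e).
  rewrite !cs; have /= := sum_eq (fun e => v \in e : nat); rewrite !inE.
  have d u w : u != w -> ~~ ((v == u) && (v == w)).
    by move=> uw; case: eqP => // ->.
  move: (d _ _ xm) (d _ _ ny) (d _ _ xn) (d _ _ my) (d _ _ mn) (d _ _ xy).
  case: (v == x); case: (v == m); case: (v == n); case: (v == y) => //= _ _ _ _ _ _;
    by rewrite ?addn0 ?addn1; first [move=> -> | case=> ->].
have so' := adj_sym O'.
have so1 u w : adj O' u w -> [\/ [set u; w] = [set x; n], [set u; w] = [set m; y] | o u w].
  by rewrite inO' => /or3P[/eqP->|/eqP->|/and3P[_ _ ->]]; [constructor 1|constructor 2|constructor 3].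
have sy (u w : V) : u != w -> ((u == w) = false) * ((w == u) = false).
  by move=> uw; rewrite [w == u]eq_sym (negPf uw).
have ne := (sy _ _ xm, sy _ _ ny, sy _ _ xn, sy _ _ my, sy _ _ mn, sy _ _ xy, eqxx).
have nbr u z : adj O' u z -> [|| (u == x) && (z == n), (u == n) && (z == x),
    (u == m) && (z == y), (u == y) && (z == m)
  | [&& o u z, ~~ ((u == n) && (z == y)), ~~ ((u == y) && (z == n)),
        ~~ ((u == x) && (z == m)) & ~~ ((u == m) && (z == x))]].
  rewrite inO' !eq_set2 => /or3P[/orP[]->|/orP[]->|/and3P[h1 h2 ->]]; rewrite ?orbT //.
  by move: h1 h2; rewrite !negb_or => /andP[-> ->] /andP[-> ->]; rewrite !orbT.
have key1 z : adj O' x z -> adj O' n z -> False.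
  move=> /nbr hx /nbr; move: hx; rewrite !ne /= ?andbT ?orbF.
  case/orP=> [/eqP zn|/andP[oxz zm]] /orP[/eqP zx|/andP[onz zy]].
  - by move: xn; rewrite -zx zn eqxx.
  - by rewrite zn /o oI in onz.
  - by rewrite zx /o oI in oxz.
  have zj : z = j.
    have := do_ n y z j ony onz onj.
    by rewrite [y == z]eq_sym (negPf zy) [y == j]eq_sym (negPf jy) orbF => /eqP.
  by subst z; rewrite oxz (negPf zm) in hj.
have key2 z : adj O' m z -> adj O' y z -> False.
  move=> /nbr hm /nbr; move: hm; rewrite !ne /= ?andbT ?orbF.
  case/orP=> [/eqP zy|/andP[omz zx]] /orP[/eqP zm|/andP[oyz zn]].
  - by move: my; rewrite -zy zm eqxx.
  - by rewrite zy /o oI in oyz.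
  - by rewrite zm /o oI in omz.
  have zi : z = i.
    have omx : o m x by rewrite so.
    have := do_ m x z i omx omz omi.
    by rewrite [x == z]eq_sym (negPf zx) [x == i]eq_sym (negPf ix) orbF => /eqP.
  by subst z; rewrite oyz (negPf zn) in hi.
have tO' : tf2_matching E O'.
  apply/andP; split; first by apply/andP; split=> //; apply/forallP.
  apply/no_triangleP; first exact: simple_sub O'E.
  have nO := no_triangleP (simple_sub sE OE) (proj2 (andP tO)).
  have key u w t : adj O' u w -> adj O' u t -> adj O' w t -> o u w.
    move=> uw ut wt; case: (so1 u w uw) => // /eqP; rewrite eq_set2;
      case/orP=> /andP[/eqP e1 /eqP e2]; subst u w.
    - by case: (key1 t).
    - by case: (key1 t).
    - by case: (key2 t).
    - by case: (key2 t).
  move=> u w t uw wt ut; apply: (nO u w t); first exact: key uw ut wt.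
    by apply: key wt _ _; rewrite so'; [apply: uw | apply: ut].
  by apply: key ut uw _; rewrite so'.
have cO' : #|O'| = #|O|.
  by have := sum_eq (fun=> 1); rewrite !sum1_card; clear; lia.
(* Two edges outside [A] were traded for two edges of [A]. *)
have := Oclosest tO' cO'.
have ci (Q : {set {set V}}) : #|Q :&: A| = \sum_(e in Q) (e \in A).
  rewrite -sum1_card big_mkcond [RHS]big_mkcond; apply: eq_bigr => e _.
  by rewrite !inE; case: (e \in Q); case: (e \in A).
rewrite !ci; have := sum_eq (fun e => e \in A : nat).
rewrite -/(adj A n y) -/(adj A x m) -/(adj A m y) -/(adj A x n) -/a.
by rewrite (negPf axm) (negPf any_) axn amy !addn0 => ->; rewrite !addn1 ltnNge leqnSn.
Qed.

End Reversal.

(** In the first two configurations the reversed segment is the middle edge of the blue path; in the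
    third it is the two-edge segment [v t p]. *)
Lemma closest_irreducible (V : finType) (E A O : {set {set V}}) :
  simple_graph E -> tf2_matching E A -> tf2_matching E O ->
  (forall O', tf2_matching E O' -> #|O'| = #|O| -> #|O' :&: A| <= #|O :&: A|) ->
  irreducible (adj A) (adj O).
Proof.
move=> sE tA tO Omax.
have [OE do_] := two_matchingP O sE (proj1 (andP tO)).
have [AE da] := two_matchingP A sE (proj1 (andP tA)).
have so := @adj_sym _ O; have sa := @adj_sym _ A.
have oI := adj_irr (simple_sub sE OE); have aI := adj_irr (simple_sub sE AE).
have sb := only_sym so sa; have sr := only_sym sa so.
have rev := no_reversal sE tA tO Omax.
have bo x y : only (adj O) (adj A) x y -> adj O x y by case/andP.
have rne x y : only (adj A) (adj O) x y -> x != y.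
  by case/andP=> h _; apply/eqP=> e; rewrite e aI in h.
have bne x y : only (adj O) (adj A) x y -> x != y.
  by case/andP=> h _; apply/eqP=> e; rewrite e oI in h.
have br x y : only (adj O) (adj A) x y -> only (adj A) (adj O) x y -> False.
  by case/andP=> h _ /andP[_]; rewrite h.
split=> //.
- move=> x y z t xz zt ty zy yx xt.
  apply: (rev x y z t t z) => //; rewrite ?eqxx //; try exact: bo.
  + by rewrite eq_sym rne.
  + by rewrite so bo.
  + exact: rne.
- move=> w v p s t wv vp ps sv vt tp pw.
  apply: (rev w s v p p v) => //; rewrite ?eqxx //; try exact: bo.
  + by rewrite sr.
  + by rewrite sr.
  + exact: rne.
  + by rewrite so bo.
  + by rewrite eq_sym rne.
- move=> w v p s t wv vp ps sv vt tp pw.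
  have otv : adj O t v by rewrite so bo.
  have otp : adj O t p by rewrite bo.
  (* The two neighbours of [t] in [O] are already [v] and [p]. *)
  have far z : z != v -> z != p -> ~~ adj O z t.
    move=> zv zp; rewrite so; apply/negP=> otz; have := do_ t v p z otv otp otz.
    by rewrite (negPf (rne _ _ vp)) [p == z]eq_sym [v == z]eq_sym (negPf zv) (negPf zp).
  apply: (rev s w v p t t) => //; try exact: bo.
  + by rewrite sr.
  + by rewrite sr.
  + by apply/eqP=> e; subst t; apply: br tp _; rewrite sr.
  + by rewrite so.
  + by apply/eqP=> e; subst t; apply: br vt _; rewrite sr.
  + by rewrite far ?orbT // ?(bne _ _ sv) // eq_sym rne.
  + by rewrite far ?orbT // ?(rne _ _ wv) // eq_sym bne.
Qed.

(** A component with a surplus of blue edges gives an improving exchange, so it has more than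
    [2 * k] edges, while its surplus is only one. Summing the resulting inequalities bounds
    [2k(|O| - |A|)] by [|O| + |A|], hence by [2|O|]. *)
Theorem local_optimum (V : finType) (E A Omax : {set {set V}}) (k : nat) :
  simple_graph E -> tf2_matching E A ->
  (forall D : {set {set V}}, D \subset E -> #|D| <= 2 * k -> tf2_matching E (symd A D) ->
     #|symd A D| <= #|A|) ->
  max_tf2_matching E Omax -> k * #|Omax| <= k * #|A| + #|Omax|.
Proof.
move=> sE tA Aloc [tOmax maxO].
pose ok (O : {set {set V}}) := tf2_matching E O && (#|O| == #|Omax|).
have ok0 : ok Omax by rewrite /ok tOmax eqxx.
case: (arg_maxnP (fun O : {set {set V}} => #|O :&: A|) ok0).
move=> O /andP[tO /eqP cO] Ocl.
have irr : irreducible (adj A) (adj O).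
  apply: (closest_irreducible sE) => // O' tO' cO'.
  by apply: Ocl; rewrite /ok tO' cO' cO eqxx.
have [P PP] := pairing_exists irr.
have [AE _] := two_matchingP A sE (proj1 (andP tA)).
have [OE _] := two_matchingP O sE (proj1 (andP tO)).
pose rt : {set V} -> {set V} := fingraph.root (linked P).
pose part (X : {set {set V}}) (r : {set V}) := [set e in X | rt e == r].
have sum_part (X : {set {set V}}) : #|X| = \sum_r #|part X r|.
  rewrite -sum1_card (partition_big rt predT) //=; apply: eq_bigr => r _.
  by rewrite -sum1_card; apply: eq_bigl => e; rewrite inE.
have local_ineq r : (2 * k) * #|part (O :\: A) r|
    <= (2 * k) * #|part (A :\: O) r| + (#|part (O :\: A) r| + #|part (A :\: O) r|).
  have [|] := leqP #|part (O :\: A) r| #|part (A :\: O) r|.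
    by move=> h; apply: leq_trans (leq_addr _ _); rewrite leq_mul2l h orbT.
  move=> gain; have /set0Pn[e0] : part (O :\: A) r != set0.
    by rewrite -card_gt0; apply: leq_ltn_trans gain.
  rewrite inE => /andP[_ /eqP e0r].
  have partE (X : {set {set V}}) : part X r = [set e in X | connect (linked P) e0 e].
    apply/setP=> e; rewrite !inE -e0r /rt eq_sym root_connect //.
    exact: connect_linked_sym.
  have gain1 : #|part (O :\: A) r| <= #|part (A :\: O) r|.+1.
    by rewrite !partE; apply: component_gain sE AE PP.
  have gainE : #|part (O :\: A) r| = #|part (A :\: O) r|.+1.
    by apply/eqP; rewrite eqn_leq gain1 gain.
  pose D := part (symd A O) r.
  have cD : #|D| = #|part (O :\: A) r| + #|part (A :\: O) r|.
    rewrite -cardsUI [X in _ = _ + X]eq_card0 ?addn0; last first.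
      by move=> e; rewrite !inE; case: (e \in A); rewrite ?andbF.
    apply: eq_card => e; rewrite !inE.
    by case: (e \in A); case: (e \in O); rewrite ?orbF.
  have DAO : D \subset symd A O by apply/subsetP=> e; rewrite inE => /andP[].
  have Dc : closed_under P D.
    move=> v p q pq; have [_ /(_ _ _ pq) /andP[/andP[b1 b2] /andP[r1 r2]] _ _] := PP v.
    rewrite inE [RHS]inE !in_symd /rt (linked_root pq).
    by move: b1 b2 r1 r2; rewrite /adj => -> /negPf-> -> /negPf->.
  have tD := symd_tf2 sE tA tO irr PP DAO Dc.
  have DE : D \subset E.
    apply: subset_trans DAO _; apply/subsetP=> e; rewrite !inE.
    by case/orP=> /andP[_]; apply/subsetP.
  have bigger : #|A| < #|symd A D|.
    have cc (X : {set {set V}}) : #|X| = \sum_e (e \in X) by rewrite -sum1_card big_mkcond.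
    have e1 : #|symd A D| + #|part (A :\: O) r| = #|A| + #|part (O :\: A) r|.
      rewrite !cc -!big_split; apply: eq_bigr => e _ /=; rewrite in_symd !inE.
      by case: (e \in A); case: (e \in O); case: (rt e == r).
    by rewrite gainE addnS -addSn in e1; move/addIn: e1 => ->.
  have : 2 * k < #|D|.
    rewrite ltnNge; apply/negP=> small.
    by have := Aloc D DE small tD; rewrite leqNgt bigger.
  by rewrite cD gainE mulnS => h; rewrite addnC leq_add2l ltnW.
have total : (2 * k) * #|O :\: A| <= (2 * k) * #|A :\: O| + (#|O :\: A| + #|A :\: O|).
  rewrite !sum_part !big_distrr /= -!big_split /=.
  by apply: leq_sum => r _; apply: local_ineq.
have hO := cardsID A O; have hA := cardsID O A.
have AO : #|A| <= #|Omax| by apply: maxO.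
rewrite setIC in hO; rewrite -cO in AO *.
move: total; rewrite -hO -hA in AO *.
set c := #|A :&: O| in AO *; move: #|A :\: O| #|O :\: A| c AO.
clear; move=> rr bb c h1; rewrite -!mulnA !mulnDr; lia.
Qed.

(** * A loop language and its compilation *)

Lemma upd_same f a v : upd f a v a = v.
Proof. by rewrite /upd eqxx. Qed.

Lemma upd_other f a v b : b != a -> upd f a v b = f b.
Proof. by rewrite /upd => /negPf->. Qed.

Definition runs (p : prog) (s s' : state) (T : nat) :=
  exists2 t, t <= T & exec p s s' t.

Lemma runs_seq p q s1 s2 s3 T1 T2 :
  runs p s1 s2 T1 -> runs q s2 s3 T2 -> runs (Seq p q) s1 s3 (T1 + T2).
Proof.
move=> [t1 h1 e1] [t2 h2 e2]; exists (t1 + t2); first exact: leq_add.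
exact: exec_Seq e1 e2.
Qed.

Lemma runs1 p s s' : exec p s s' 1 -> runs p s s' 1.
Proof. by exists 1. Qed.

Lemma runs_while x body (Inv : nat -> state -> Prop) T :
  (forall k s, Inv k.+1 s -> reg s x = k.+1 ->
     exists s', [/\ runs body s s' T, Inv k s' & reg s' x = k]) ->
  forall k s, Inv k s -> reg s x = k ->
     exists2 s', runs (While x body) s s' (k * T.+1).+1 & Inv 0 s'.
Proof.
move=> step; elim=> [|k IH] s I0 sx.
  by exists s => //; apply: runs1; apply: exec_WhileF.
have [s1 [[t1 h1 e1] I1 sx1]] := step k s I0 sx.
have [s2 [t2 h2 e2] I2] := IH s1 I1 sx1.
exists s2 => //; exists (t1 + t2).+1; first by rewrite mulSn; lia.
by apply: exec_WhileT e1 e2; rewrite sx.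
Qed.

(* In [ESum i v a] and [CFor i v c] the bound is the value of the variable [v].  The
   only variables are loop indices, which are immutable: all mutable data live
   in memory, so that the semantics of a command is a memory transformer, and
   running times depend only on a bound on the variables. *)
Inductive expr :=
| EVar (v : nat)
| EConst (c : nat)
| EAdd (a b : expr)
| ESub (a b : expr)
| ERead (a : expr)
| ESum (i v : nat) (a : expr).

Fixpoint eval (e : expr) (env mem : nat -> nat) : nat :=
  match e with
  | EVar v => env v
  | EConst c => c
  | EAdd a b => eval a env mem + eval b env mem
  | ESub a b => eval a env mem - eval b env mem
  | ERead a => mem (eval a env mem)
  | ESum i v a => \sum_(k < env v) eval a (upd env i k) mem
  end.

Inductive cmd :=
| CWrite (a e : expr)
| CSeq (c d : cmd)
| CIf (e : expr) (c : cmd)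
| CFor (i v : nat) (c : cmd).

(** Through [foldr] the loop index runs downwards to 0, as the countdown of the compiled loop
    does. *)
Fixpoint sem (c : cmd) (env mem : nat -> nat) : nat -> nat :=
  match c with
  | CWrite a e => upd mem (eval a env mem) (eval e env mem)
  | CSeq c d => sem d env (sem c env mem)
  | CIf e c => if eval e env mem == 0 then mem else sem c env mem
  | CFor i v c => foldr (fun k m => sem c (upd env i k) m) mem (iota 0 (env v))
  end.

(* [ctx] maps variables to registers below [x]; the registers from [x] on are
   scratch space, and the value is left in [x]. *)
Fixpoint compile_expr (e : expr) (ctx : nat -> nat) (x : nat) : prog :=
  match e with
  | EVar v => Seq (Const x 0) (Add x x (ctx v))
  | EConst c => Const x c
  | EAdd a b =>
      Seq (compile_expr a ctx x) (Seq (compile_expr b ctx x.+1) (Add x x x.+1))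
  | ESub a b =>
      Seq (compile_expr a ctx x) (Seq (compile_expr b ctx x.+1) (Defs.Sub x x x.+1))
  | ERead a => Seq (compile_expr a ctx x) (Read x x)
  | ESum i v a =>
      Seq (Const x 0) (Seq (Const x.+1 0) (Seq (Add x.+1 x.+1 (ctx v))
        (While x.+1 (Seq (Const x.+2 1) (Seq (Defs.Sub x.+1 x.+1 x.+2)
           (Seq (compile_expr a (upd ctx i x.+1) x.+2) (Add x x x.+2)))))))
  end.

Fixpoint compile (c : cmd) (ctx : nat -> nat) (x : nat) : prog :=
  match c with
  | CWrite a e =>
      Seq (compile_expr a ctx x) (Seq (compile_expr e ctx x.+1) (Write x x.+1))
  | CSeq c d => Seq (compile c ctx x) (compile d ctx x)
  | CIf e c => Seq (compile_expr e ctx x) (If x (compile c ctx x.+1) Skip)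
  | CFor i v c =>
      Seq (Const x 0) (Seq (Add x x (ctx v))
        (While x (Seq (Const x.+1 1) (Seq (Defs.Sub x x x.+1)
           (compile c (upd ctx i x) x.+1)))))
  end.

(** Here [N] bounds all variables, and thus the length of every loop. *)
Fixpoint cost_expr (e : expr) (N : nat) : nat :=
  match e with
  | EVar _ => 2
  | EConst _ => 1
  | EAdd a b | ESub a b => cost_expr a N + (cost_expr b N + 1)
  | ERead a => cost_expr a N + 1
  | ESum _ _ a => 1 + (1 + (1 + (N * (1 + (1 + (cost_expr a N + 1))).+1).+1))
  end.

Fixpoint cost (c : cmd) (N : nat) : nat :=
  match c with
  | CWrite a e => cost_expr a N + (cost_expr e N + 1)
  | CSeq c d => cost c N + cost d N
  | CIf e c => cost_expr e N + (cost c N).+2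
  | CFor _ _ c => 1 + (1 + (N * (1 + (1 + cost c N)).+1).+1)
  end.

Lemma eval_ext e env env' mem : env =1 env' -> eval e env mem = eval e env' mem.
Proof.
elim: e env env' => //= [a IHa b IHb|a IHa b IHb|a IHa|i v a IHa] env env' ee.
- by rewrite (IHa _ _ ee) (IHb _ _ ee).
- by rewrite (IHa _ _ ee) (IHb _ _ ee).
- by rewrite (IHa _ _ ee).
- rewrite (ee v); apply: eq_bigr => k _; apply: IHa => w.
  by rewrite /upd; case: eqP.
Qed.

Lemma sem_ext c env env' mem : env =1 env' -> sem c env mem = sem c env' mem.
Proof.
elim: c env env' mem => /= [a e|c IHc d IHd|e c IHc|i v c IHc] env env' mem ee.
- by rewrite !(eval_ext _ _ ee).
- by rewrite (IHc _ _ _ ee) (IHd _ _ _ ee).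
- by rewrite (eval_ext _ _ ee) (IHc _ _ _ ee).
- rewrite (ee v); elim: (iota _ _) => //= k l ->; apply: IHc => w.
  by rewrite /upd; case: eqP.
Qed.

Lemma upd_ctx (r ctx : nat -> nat) i x :
  (fun v => r (upd ctx i x v)) =1 upd (fun v => r (ctx v)) i (r x).
Proof. by move=> v; rewrite /upd; case: eqP. Qed.

Lemma upd_ctx_lt ctx i x y : (forall v, ctx v < x) -> x <= y ->
  forall v, upd ctx i y v < y.+1.
Proof.
move=> h xy v; rewrite /upd; case: eqP => // _.
by apply: leq_trans (h v) _; apply: leqW.
Qed.

(** Leaving the registers below [x] untouched protects enclosing loop counters and pending
    intermediate values. *)
Lemma compile_exprP e ctx x s N : (forall v, ctx v < x) ->
  (forall v, reg s (ctx v) <= N) ->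
  exists s', [/\ runs (compile_expr e ctx x) s s' (cost_expr e N),
    Defs.mem s' = Defs.mem s, forall y, y < x -> reg s' y = reg s y
    & reg s' x = eval e (fun v => reg s (ctx v)) (Defs.mem s)].
Proof.
elim: e ctx x s => /= [v|c|a IHa b IHb|a IHa b IHb|a IHa|i v a IHa] ctx x s cx sN.
- eexists; split.
  + apply: (runs_seq (T1 := 1) (T2 := 1)); apply: runs1.
      exact: exec_Const.
    exact: exec_Add.
  + by [].
  + by move=> y yx /=; rewrite !upd_other // ltn_eqF.
  + by rewrite /= !upd_same upd_other // ltn_eqF.
- eexists; split; first by apply: runs1; apply: exec_Const.
  + by [].
  + by move=> y yx /=; rewrite upd_other // ltn_eqF.
  + by rewrite /= upd_same.
- have [s1 [r1 m1 p1 v1]] := IHa _ _ _ cx sN.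
  have [|v|s2 [r2 m2 p2 v2]] := IHb ctx x.+1 s1 _ _.
  + by move=> v; apply: ltnW (cx v).
  + by rewrite p1.
  eexists; split.
  + apply: runs_seq r1 _; apply: runs_seq r2 _; apply: runs1.
    exact: exec_Add.
  + by rewrite /= m2.
  + by move=> y yx /=; rewrite upd_other ?ltn_eqF // p2 ?p1 // ltnW.
  + rewrite /= upd_same p2 // v1 v2 m1; congr (_ + _).
    by apply: eval_ext => v; rewrite p1.
- have [s1 [r1 m1 p1 v1]] := IHa _ _ _ cx sN.
  have [|v|s2 [r2 m2 p2 v2]] := IHb ctx x.+1 s1 _ _.
  + by move=> v; apply: ltnW (cx v).
  + by rewrite p1.
  eexists; split.
  + apply: runs_seq r1 _; apply: runs_seq r2 _; apply: runs1.
    exact: exec_Sub.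
  + by rewrite /= m2.
  + by move=> y yx /=; rewrite upd_other ?ltn_eqF // p2 ?p1 // ltnW.
  + rewrite /= upd_same p2 // v1 v2 m1; congr (_ - _).
    by apply: eval_ext => v; rewrite p1.
- have [s1 [r1 m1 p1 v1]] := IHa _ _ _ cx sN.
  eexists; split.
  + by apply: runs_seq r1 _; apply: runs1; apply: exec_Read.
  + by rewrite /= m1.
  + by move=> y yx /=; rewrite upd_other ?ltn_eqF // p1.
  + by rewrite /= upd_same v1 m1.
- pose env := fun v => reg s (ctx v).
  pose s0 := set_reg (set_reg (set_reg s x 0) x.+1 0) x.+1
               (0 + reg s (ctx v)).
  (* The sum is accumulated from its last term downwards, with [k] terms still to come. *)
  pose Inv k s' := [/\ k <= env v, Defs.mem s' = Defs.mem s, forall y, y < x -> reg s' y = reg s y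
    & reg s' x = \sum_(k <= l < env v) eval a (upd env i l) (Defs.mem s)].
  have cx2 := upd_ctx_lt i (y := x.+1) cx (leqnSn x).
  have s0v : reg s0 x.+1 = env v by rewrite /= upd_same.
  have I0 : Inv (env v) s0.
    split=> //.
      by move=> y yx; rewrite /= !upd_other // ltn_eqF // ltnW.
    by rewrite big_geq //= upd_other ?ltn_eqF // upd_other ?ltn_eqF // upd_same.
  pose body := Seq (Const x.+2 1) (Seq (Defs.Sub x.+1 x.+1 x.+2)
    (Seq (compile_expr a (upd ctx i x.+1) x.+2) (Add x x x.+2))).
  have step k s1 : Inv k.+1 s1 -> reg s1 x.+1 = k.+1 ->
      exists s2, [/\ runs body s1 s2 (1 + (1 + (cost_expr a N + 1))), Inv k s2
        & reg s2 x.+1 = k].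
    move=> [kv m1 p1 v1] xk.
    pose s2 := set_reg (set_reg s1 x.+2 1) x.+1 k.
    have rk : k <= N by apply: leq_trans (ltnW kv) (sN v).
    have [w|s3 [r3 m3 p3 v3]] := IHa _ x.+2 s2 cx2 _.
      rewrite /= upd_ctx upd_same /upd; case: eqP => // _.
      by rewrite !ltn_eqF ?p1 ?sN //; have := cx w; lia.
    eexists; split.
    * apply: runs_seq; first by apply: runs1; apply: exec_Const.
      apply: runs_seq.
        apply: runs1; have := exec_Sub (set_reg s1 x.+2 1) x.+1 x.+1 x.+2.
        by rewrite /= upd_same upd_other ?ltn_eqF // xk subn1; apply.
      apply: runs_seq r3 _; apply: runs1; exact: exec_Add.
    * split=> //=; first exact: ltnW.
      - by rewrite m3.
      - move=> y yx; rewrite upd_other ?ltn_eqF // p3 /=; last by lia.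
        by rewrite !upd_other ?p1 //; apply/eqP; lia.
      - rewrite upd_same p3 /=; last by lia.
        rewrite upd_other ?upd_other; try by apply/eqP; lia.
        rewrite v1 v3 [in RHS]big_ltn // addnC; congr (_ + _).
        rewrite /= m1; apply: eval_ext => w; rewrite upd_ctx upd_same /upd.
        case: eqP => // _; rewrite !ltn_eqF ?p1 //; have := cx w; lia.
    * rewrite /= upd_other; last by rewrite gtn_eqF.
      by rewrite p3 //= upd_same.
  have [s' r' [_ m' p' v']] := runs_while step I0 s0v.
  exists s'; split=> //.
  + apply: runs_seq; first by apply: runs1; apply: exec_Const.
    apply: runs_seq; first by apply: runs1; apply: exec_Const.
    apply: runs_seq.
      apply: runs1; have := exec_Add (set_reg (set_reg s x 0) x.+1 0) x.+1 x.+1 (ctx v).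
      rewrite [in X in exec _ _ X _]/= upd_same upd_other; last by rewrite ltn_eqF //; have := cx v; lia.
      by rewrite upd_other ?ltn_eqF //; apply.
    case: r' => t ht et; exists t => //; apply: leq_trans ht _.
    by rewrite ltnS leq_mul2r; apply/orP; right; apply: sN.
  + by rewrite v' big_mkord.
Qed.

Lemma compileP c ctx x s N : (forall v, ctx v < x) ->
  (forall v, reg s (ctx v) <= N) ->
  exists s', [/\ runs (compile c ctx x) s s' (cost c N),
    forall y, y < x -> reg s' y = reg s y
    & Defs.mem s' = sem c (fun v => reg s (ctx v)) (Defs.mem s)].
Proof.
elim: c ctx x s => /= [a e|c IHc d IHd|e c IHc|i v c IHc] ctx x s cx sN.
- have [s1 [r1 m1 p1 v1]] := compile_exprP a cx sN.
  have cx1 v : ctx v < x.+1 by apply: ltnW (cx v).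
  have [v|s2 [r2 m2 p2 v2]] := compile_exprP e (N := N) (s := s1) cx1 _.
    by rewrite p1.
  eexists; split.
  + apply: runs_seq r1 _; apply: runs_seq r2 _; apply: runs1; exact: exec_Write.
  + by move=> y yx /=; rewrite p2 ?p1 // ltnW.
  + rewrite /= v2 m2 p2 // v1 m1; congr upd.
    by apply: eval_ext => v; rewrite p1.
- have [s1 [r1 p1 m1]] := IHc _ _ _ cx sN.
  have [v|s2 [r2 p2 m2]] := IHd ctx x s1 cx _; first by rewrite p1.
  exists s2; split.
  + exact: runs_seq r1 r2.
  + by move=> y yx; rewrite p2 ?p1.
  + by rewrite m2 m1; apply: sem_ext => v; rewrite p1.
- have [s1 [r1 m1 p1 v1]] := compile_exprP e cx sN.
  have cx1 v : ctx v < x.+1 by apply: ltnW (cx v).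
  have [v|s2 [[t2 ht2 r2] p2 m2]] := IHc ctx x.+1 s1 cx1 _; first by rewrite p1.
  case: eqP => e0.
    (* Two steps: the test and [Skip]. *)
    exists s1; split=> //; apply: runs_seq r1 _; exists 2 => //.
    by apply: exec_IfF; [rewrite v1|constructor].
  exists s2; split.
  + apply: runs_seq r1 _; exists t2.+1; first by rewrite ltnW.
    by apply: exec_IfT; [rewrite v1; apply/eqP|].
  + by move=> y yx; rewrite p2 ?p1 // ltnW.
  + by rewrite m2 m1; apply: sem_ext => v; rewrite p1.
- pose env := fun v => reg s (ctx v).
  pose s0 := set_reg (set_reg s x 0) x (0 + reg s (ctx v)).
  pose f k m := sem c (upd env i k) m.
  (* The remaining [k] iterations lead from the current memory to the final one. *)
  pose Inv k s' := [/\ k <= env v, forall y, y < x -> reg s' y = reg s y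
    & foldr f (Defs.mem s') (iota 0 k) = foldr f (Defs.mem s) (iota 0 (env v))].
  have cx1 := upd_ctx_lt i (y := x) cx (leqnn x).
  have s0v : reg s0 x = env v by rewrite /= upd_same.
  have I0 : Inv (env v) s0.
    by split=> // y yx; rewrite /= !upd_other // ltn_eqF.
  pose body := Seq (Const x.+1 1) (Seq (Defs.Sub x x x.+1)
    (compile c (upd ctx i x) x.+1)).
  have step k s1 : Inv k.+1 s1 -> reg s1 x = k.+1 ->
      exists s2, [/\ runs body s1 s2 (1 + (1 + cost c N)), Inv k s2 & reg s2 x = k].
    move=> [kv p1 m1] xk.
    pose s2 := set_reg (set_reg s1 x.+1 1) x k.
    have rk : k <= N by apply: leq_trans (ltnW kv) (sN v).
    have ee w : reg s2 (upd ctx i x w) = upd env i k w.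
      rewrite /= upd_ctx upd_same /upd; case: eqP => // _.
      by rewrite !ltn_eqF ?p1 //; have := cx w; lia.
    have [w|s3 [r3 p3 m3]] := IHc _ x.+1 s2 cx1 _.
      by rewrite ee /upd /env; case: eqP => // _; apply: sN.
    exists s3; split.
    + apply: runs_seq; first by apply: runs1; apply: exec_Const.
      apply: (runs_seq _ r3); apply: runs1; have := exec_Sub (set_reg s1 x.+1 1) x x x.+1.
      by rewrite /= upd_same upd_other ?ltn_eqF // xk subn1; apply.
    + split; first exact: ltnW.
        move=> y yx; rewrite p3 /=; last by lia.
        by rewrite !upd_other ?p1 //; apply/eqP; lia.
      rewrite -m1 -addn1 iotaD foldr_cat /= m3; congr foldr.
      by rewrite /f; apply: sem_ext => w; rewrite ee.
    + by rewrite p3 //= upd_same.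
  have [s' r' [_ p' m']] := runs_while step I0 s0v.
  exists s'; split=> //.
  apply: runs_seq; first by apply: runs1; apply: exec_Const.
  apply: runs_seq.
    apply: runs1; have := exec_Add (set_reg s x 0) x x (ctx v).
    rewrite [in X in exec _ _ X _]/= upd_same upd_other; last by rewrite ltn_eqF.
    by apply.
  case: r' => t ht et; exists t => //; apply: leq_trans ht _.
  by rewrite ltnS leq_mul2r; apply/orP; right; apply: sN.
Qed.

(** * Polynomial bounds on the cost *)

Definition polynomial (f : nat -> nat) := exists p : {poly nat}, forall N, f N = p.[N]%R.

Lemma polynomial_const k : polynomial (fun=> k).
Proof. by exists k%:P%R => N; rewrite hornerC. Qed.

Lemma polynomial_id : polynomial id.
Proof. by exists 'X%R => N; rewrite hornerX. Qed.

Lemma polynomial_add f g : polynomial f -> polynomial g ->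
  polynomial (fun N => f N + g N).
Proof. by move=> [p fp] [q gq]; exists (p + q)%R => N; rewrite hornerD fp gq. Qed.

Lemma polynomial_mul f g : polynomial f -> polynomial g ->
  polynomial (fun N => f N * g N).
Proof. by move=> [p fp] [q gq]; exists (p * q)%R => N; rewrite hornerM fp gq. Qed.

Lemma polynomial_S f : polynomial f -> polynomial (fun N => (f N).+1).
Proof. exact: polynomial_add (polynomial_const 1). Qed.

#[local] Hint Resolve polynomial_const polynomial_id polynomial_add polynomial_mul polynomial_S : core.

Lemma cost_expr_poly e : polynomial (cost_expr e).
Proof. by elim: e => /=; auto 20. Qed.

#[local] Hint Resolve cost_expr_poly : core.

Lemma cost_poly c : polynomial (cost c).
Proof. by elim: c => /=; auto 20. Qed.

(** * The local search program *)

(* Variable 0 is the number [n] of nodes.  Cells [0 .. n^2 - 1] hold the input graph,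
   the next [n^2] cells the current candidate, then come a success flag and
   the size to be reached.  Candidates are sets of ordered pairs, which the
   search changes one pair at a time: symmetry is part of the validity test. *)
Definition e_square := ESum 9 0 (EVar 0).
(** Products are repeated sums over the dummy variable 9; this is [i * n + j]. *)
Definition e_idx i j := EAdd (ESum 9 i (EVar 0)) (EVar j).
Definition e_edge i j := ERead (e_idx i j).
Definition e_addr i j := EAdd e_square (e_idx i j).
Definition e_cell i j := ERead (e_addr i j).
Definition e_flag := EAdd e_square e_square.
Definition e_target := EAdd e_flag (EConst 1).
Definition e_size := ESum 1 0 (ESum 2 0 (e_cell 1 2)).

Definition e_invalid :=
  EAdd (EAdd (EAdd
    (ESum 1 0 (ESum 2 0 (ESub (e_cell 1 2) (e_edge 1 2))))
    (ESum 1 0 (ESum 2 0 (ESub (e_cell 1 2) (e_cell 2 1)))))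
    (ESum 1 0 (ESub (ESum 2 0 (e_cell 1 2)) (EConst 2))))
    (ESum 1 0 (ESum 2 0 (ESum 3 0
       (ESub (EAdd (EAdd (e_cell 1 2) (e_cell 2 3)) (e_cell 1 3)) (EConst 2))))).

(** By truncation the flag becomes 1 exactly when the candidate has no violation and reaches the
    target size, and 0 otherwise. *)
Definition c_check :=
  CWrite e_flag
    (ESub (EConst 1) (EAdd e_invalid (ESub (ERead e_target) e_size))).
Definition c_toggle := CWrite (e_addr 1 2) (ESub (EConst 1) (e_cell 1 2)).
Definition c_unless c := CIf (ESub (EConst 1) (ERead e_flag)) c.
Definition c_pairs c := CFor 1 0 (CFor 2 0 c).

(** A backtracking search of fixed depth [d]: each flip is undone unless the flag reports success,
    after which the guards freeze the candidate. *)
Fixpoint c_search (d : nat) : cmd :=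
  if d is d'.+1 then
    CSeq c_check (c_pairs (c_unless
      (CSeq c_toggle (CSeq (c_search d') (c_unless c_toggle)))))
  else c_check.

Definition c_round d :=
  CSeq (CWrite e_target (EAdd e_size (EConst 1))) (c_search d).
(* Every successful round enlarges the candidate, so one of [n^2 + 1] rounds fails,
   after which nothing changes any more. *)
Definition c_main d :=
  CSeq (c_pairs (c_round d))
    (CSeq (c_round d) (c_pairs (CWrite (e_idx 1 2) (e_cell 1 2)))).

(** * Correctness of the search program *)

Lemma symdA (T : finType) (X Y Z : {set T}) :
  symd X (symd Y Z) = symd (symd X Y) Z.
Proof. by apply/setP=> x; rewrite !in_symd addbA. Qed.

Lemma symd0 (T : finType) (X : {set T}) : symd X set0 = X.
Proof. by apply/setP=> x; rewrite in_symd inE addbF. Qed.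

Lemma symdK (T : finType) (Y X : {set T}) : symd (symd X Y) Y = X.
Proof. by apply/setP=> x; rewrite !in_symd addbK. Qed.

Lemma card_symd1 (T : finType) (Y : {set T}) p : #|symd [set p] Y| <= #|Y|.+1.
Proof.
have sub : symd [set p] Y \subset p |: Y.
  by apply/subsetP=> x; rewrite in_symd !inE; case: (x == p); case: (x \in Y).
apply: leq_trans (subset_leq_card sub) _; rewrite cardsU1.
by case: (p \notin Y).
Qed.

Lemma symd1_setD1 (T : finType) (Y : {set T}) p : p \in Y ->
  symd [set p] (Y :\ p) = Y.
Proof.
move=> pY; apply/setP=> x; rewrite in_symd !inE.
by have [->|_] := eqVneq x p; rewrite ?pY.
Qed.

Lemma foldr_iota_ind (S : Type) (P : nat -> S -> Prop) f N (a : S) :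
  P N a -> (forall k b, k < N -> P k.+1 b -> P k (f k b)) ->
  P 0 (foldr f a (iota 0 N)).
Proof.
elim: N a => [//|N IH] a PN step.
rewrite -addn1 iotaD foldr_cat /=; apply: IH; first exact: step.
by move=> k b kN; apply: step; apply: ltnW.
Qed.

Lemma eval_sumE n i v a env m (F : 'I_n -> nat) : env v = n ->
  (forall k : 'I_n, eval a (upd env i k) m = F k) ->
  eval (ESum i v a) env m = \sum_k F k.
Proof. by move=> e; subst n => h /=; apply: eq_bigr. Qed.

Section Program.
Variable n : nat.
Local Notation pair := ('I_n * 'I_n)%type.
Implicit Types (p : pair) (X Y S : {set pair}) (m env : nat -> nat).

(** The invariant depends on the set of pairs already visited, which hides the order of the two
    loops. *)
Lemma sem_pairs env c (I : {set pair} -> (nat -> nat) -> Prop) m : env 0 = n ->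
  (forall S p m, I S m -> I (p |: S) (sem c (upd (upd env 1 p.1) 2 p.2) m)) ->
  I set0 m -> I setT (sem (c_pairs c) env m).
Proof.
move=> e0 step I0 /=.
(* The loops count down, so the visited pairs are final segments of the lexicographic order. *)
pose S1 k := [set p : pair | k <= p.1].
pose S2 k l := [set p : pair | (k < p.1) || (k == p.1) && (l <= p.2)].
have <- : S1 0 = setT by apply/setP=> p; rewrite !inE.
apply: (foldr_iota_ind (P := fun k => I (S1 k))) => [|k b kn Ib].
  by rewrite (_ : S1 _ = set0) //; apply/setP=> p; rewrite !inE e0 leqNgt ltn_ord.
rewrite e0 in kn.
have -> : S1 k = S2 k 0.
  by apply/setP=> p; rewrite !inE andbT leq_eqVlt orbC.
apply: (foldr_iota_ind (P := fun l => I (S2 k l))) => [|l b' ln Ib'].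
  rewrite (_ : S2 _ _ = S1 k.+1) //; apply/setP=> p; rewrite !inE /upd /= e0.
  by rewrite [n <= _]leqNgt ltn_ord andbF orbF.
rewrite /upd /= e0 in ln.
have := step (S2 k l.+1) (Ordinal kn, Ordinal ln) b' Ib'.
congr I; apply/setP=> -[x y]; rewrite !inE xpair_eqE -!val_eqE /=.
by rewrite [val x == k]eq_sym [val y == l]eq_sym [l <= y]leq_eqVlt; case: (k < x); case: (k == x); case: (l == y).
Qed.

Definition code p := p.1 * n + p.2.

Lemma code_lt p : code p < n * n.
Proof. by case: p => x y; rewrite /code /=; have := ltn_ord x; have := ltn_ord y; nia. Qed.

Lemma code_inj : injective code.
Proof.
move=> [x y] [x' y'] e; have n0 : 0 < n by apply: leq_ltn_trans (ltn_ord x).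
have := congr1 (fun k => (k %/ n, k %% n)) e; rewrite /code /=.
rewrite !divnMDl // !divn_small ?ltn_ord // !addn0 !modnMDl !modn_small ?ltn_ord //.
by case=> /val_inj-> /val_inj->.
Qed.

Variable E : {set pair}.

Record rep X F T m : Prop := Rep {
  rep_edge : forall p, m (code p) = (p \in E);
  rep_cell : forall p, m (n * n + code p) = (p \in X);
  rep_flag : m (n * n + n * n) = F;
  rep_target : m (n * n + n * n + 1) = T }.

Lemma rep_set_flag X F T m F' : rep X F T m ->
  rep X F' T (upd m (n * n + n * n) F').
Proof.
case=> hE hX hF hT; split; rewrite ?upd_same //.
- by move=> p; rewrite upd_other //; apply/eqP; have := code_lt p; lia.
- by move=> p; rewrite upd_other //; apply/eqP; have := code_lt p; lia.
- by rewrite upd_other //; apply/eqP; lia.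
Qed.

Lemma rep_set_target X F T m T' : rep X F T m ->
  rep X F T' (upd m (n * n + n * n + 1) T').
Proof.
case=> hE hX hF hT; split; rewrite ?upd_same //.
- by move=> p; rewrite upd_other //; apply/eqP; have := code_lt p; lia.
- by move=> p; rewrite upd_other //; apply/eqP; have := code_lt p; lia.
- by rewrite upd_other //; apply/eqP; lia.
Qed.

Lemma rep_toggle X F T m p : rep X F T m ->
  rep (symd X [set p]) F T (upd m (n * n + code p) (1 - (p \in X))).
Proof.
case=> hE hX hF hT; split; try by rewrite upd_other //; apply/eqP; have := code_lt p; lia.
- move=> q; rewrite upd_other //; apply/eqP; have := code_lt q; lia.
- move=> q; rewrite in_symd inE; have [->|qp] := eqVneq q p.
    by rewrite upd_same; case: (p \in X).
  by rewrite upd_other ?hX ?addbF // eqn_add2l (inj_eq code_inj).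
Qed.

Lemma eval_square env m : env 0 = n -> eval e_square env m = n * n.
Proof. by move=> e0; rewrite /= sum_nat_const card_ord e0. Qed.

Lemma eval_idx env m i j p : env 0 = n -> env i = p.1 -> env j = p.2 ->
  eval (e_idx i j) env m = code p.
Proof. by move=> e0 ei ej; rewrite /= sum_nat_const card_ord /upd /= e0 ei ej. Qed.

Lemma eval_addr env m i j p : env 0 = n -> env i = p.1 -> env j = p.2 ->
  eval (e_addr i j) env m = n * n + code p.
Proof.
move=> e0 ei ej; rewrite -(eval_idx m e0 ei ej) -(eval_square m e0).
by [].
Qed.

Lemma eval_flag env m : env 0 = n -> eval e_flag env m = n * n + n * n.
Proof. by move=> e0; rewrite -(eval_square m e0). Qed.

Lemma eval_target env m : env 0 = n -> eval e_target env m = n * n + n * n + 1.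
Proof. by move=> e0; rewrite -(eval_flag m e0). Qed.

(* Counts violations of: being contained in [E], symmetry, the degree bound, and
   triangle-freeness; subtraction is truncated. *)
Definition invalid X : nat :=
  \sum_i \sum_j (((i, j) \in X) - ((i, j) \in E))
  + \sum_i \sum_j (((i, j) \in X) - ((j, i) \in X))
  + \sum_i (\sum_j ((i, j) \in X) - 2)
  + \sum_i \sum_j \sum_k (((i, j) \in X) + ((j, k) \in X) + ((i, k) \in X) - 2).

Section Evaluation.
Variables (X : {set pair}) (F T : nat) (env m : nat -> nat).
Hypothesis e0 : env 0 = n.
Hypothesis Xm : rep X F T m.

Lemma eval_cell (env' : nat -> nat) i j (x y : 'I_n) :
  env' 0 = n -> env' i = x -> env' j = y ->
  eval (e_cell i j) env' m = ((x, y) \in X).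
Proof. by move=> h hi hj; rewrite -(rep_cell Xm) -(@eval_addr env' m i j). Qed.

Lemma eval_edge (env' : nat -> nat) i j (x y : 'I_n) :
  env' 0 = n -> env' i = x -> env' j = y ->
  eval (e_edge i j) env' m = ((x, y) \in E).
Proof. by move=> h hi hj; rewrite -(rep_edge Xm) -(@eval_idx env' m i j). Qed.

Lemma eval_size : eval e_size env m = #|X|.
Proof.
transitivity (\sum_i \sum_j (((i : 'I_n, j : 'I_n) \in X) : nat)).
  apply: eval_sumE => // i; apply: eval_sumE => // j.
  exact: eval_cell.
rewrite pair_big /= -sum1_card [RHS]big_mkcond; apply: eq_bigr => -[i j] _.
by rewrite /=; case: ((i, j) \in X).
Qed.

Lemma eval_invalid : eval e_invalid env m = invalid X.
Proof.
have evalD a b mem : eval (EAdd a b) env mem = eval a env mem + eval b env mem by [].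
rewrite /e_invalid !evalD; congr (_ + _ + _ + _); apply: eval_sumE => // i.
- apply: eval_sumE => // j; congr (_ - _); [exact: eval_cell | exact: eval_edge].
- by apply: eval_sumE => // j; congr (_ - _); apply: eval_cell.
- rewrite (_ : eval _ _ _ = eval (ESum 2 0 (e_cell 1 2)) (upd env 1 i) m - 2) //.
  by congr (_ - _); apply: eval_sumE => // j; apply: eval_cell.
- apply: eval_sumE => // j; apply: eval_sumE => // k.
  by congr (_ + _ + _ - _); apply: eval_cell.
Qed.

Lemma sem_check :
  rep X (1 - (invalid X + (T - #|X|))) T (sem c_check env m).
Proof.
rewrite [sem _ _ _](_ : _ = upd m (n * n + n * n) (1 - (invalid X + (T - #|X|)))).
  exact: rep_set_flag Xm.
rewrite -eval_invalid -eval_size -(rep_target Xm) -(eval_target m e0).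
by rewrite -(eval_flag m e0).
Qed.

Lemma sem_unless c : sem (c_unless c) env m = if F == 0 then sem c env m else m.
Proof.
rewrite [LHS](_ : _ = if 1 - F == 0 then m else sem c env m).
  by case: (F).
by rewrite -(rep_flag Xm) -(eval_flag m e0).
Qed.

Lemma sem_toggle p : env 1 = p.1 -> env 2 = p.2 ->
  rep (symd X [set p]) F T (sem c_toggle env m).
Proof.
move=> e1 e2; rewrite [sem _ _ _](_ : _ = upd m (n * n + code p) (1 - (p \in X))).
  exact: rep_toggle.
rewrite -(eval_addr m e0 e1 e2) (surjective_pairing p).
by rewrite -(eval_cell e0 e1 e2).
Qed.

End Evaluation.

Definition improves X T := invalid X + (T - #|X|) == 0.

(** Failure restores [X] and certifies that no set of at most [d] flips would have succeeded. *)
Lemma searchP d env m X F T : env 0 = n -> rep X F T m ->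
  (exists Y, [/\ #|Y| <= d, improves (symd X Y) T
     & rep (symd X Y) 1 T (sem (c_search d) env m)]) \/
  rep X 0 T (sem (c_search d) env m) /\
    (forall Y, #|Y| <= d -> ~~ improves (symd X Y) T).
Proof.
have check env' m' X' F' (b : nat) : env' 0 = n -> rep X' F' T m' ->
    improves X' T /\ rep X' 1 T (sem c_check env' m') \/
    ~~ improves X' T /\ rep X' 0 T (sem c_check env' m').
  move=> e0 /(sem_check e0); rewrite /improves.
  by case: (_ + _) => [|k] /= h; [left|right; rewrite subSS sub0n in h].
elim: d env m X F => [|d IH] env m X F e0 Xm.
  case: (check _ _ _ _ 0 e0 Xm) => -[i r].
    by left; exists set0; rewrite cards0 symd0.
  by right; split=> // Y; rewrite leqn0 cards_eq0 => /eqP->; rewrite symd0.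
rewrite [c_search _]/=; set body := c_unless _; rewrite [sem _ _ _]/=.
set m1 := sem c_check env m; rewrite -/(sem (c_pairs body) env m1).
pose good m' := exists Y, [/\ #|Y| <= d.+1, improves (symd X Y) T
     & rep (symd X Y) 1 T m'].
(* Before success, a successful [Y] can only be nonempty and disjoint from the visited pairs, so
   none remains at the end. *)
pose I S m' := good m' \/ rep X 0 T m' /\ forall Y, #|Y| <= d.+1 ->
  improves (symd X Y) T -> Y != set0 /\ forall p, p \in S -> p \notin Y.
have : I setT (sem (c_pairs body) env m1).
  apply: sem_pairs => // [S p m' [[Y [Yd Yi Yr]]|[Xr Xs]]|].
  - left; exists Y; split=> //.
    by rewrite /body (sem_unless _ Yr).
  - set env' := upd _ 2 _; have e0' : env' 0 = n by [].
    set m2 := sem c_toggle env' m'; set m3 := sem (c_search d) env' m2.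
    rewrite /body (sem_unless _ Xr) // -[if _ then _ else _]/(sem (c_unless c_toggle) env' m3).
    have Xr2 : rep (symd X [set p]) 0 T m2 by apply: sem_toggle.
    case: (IH env' m2 _ _ e0' Xr2) => [[Y [Yd Yi Yr]]|[Xr3 Xs3]].
      rewrite (sem_unless _ Yr) //=; left; exists (symd [set p] Y).
      rewrite symdA; split=> //.
      by apply: leq_trans (card_symd1 _ _) _.
    rewrite (sem_unless _ Xr3) //=; right; split.
      by rewrite -[X in rep X _ _ _](symdK [set p] X); apply: sem_toggle.
    move=> Y Yd Yi; have [Y0 YS] := Xs Y Yd Yi; split=> // q /setU1P[->|]; last exact: YS.
    (* A successful [Y] containing [p] would have been found, as [Y] without [p], by the recursive
       search after flipping [p]. *)
    apply/negP=> pY; have := Xs3 (Y :\ p); rewrite -symdA symd1_setD1 // Yi => h.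
    by suff /h : #|Y :\ p| <= d by []; move: Yd; rewrite (cardsD1 p) pY.
  - case: (check _ _ _ _ 0 e0 Xm) => -[i r].
      by left; exists set0; rewrite cards0 symd0.
    right; split=> // Y Yd Yi; split; last by move=> p; rewrite inE.
    by apply/eqP=> Y0; subst Y; rewrite symd0 (negPf i) in Yi.
case=> [|[Xr Xs]]; [by left|right; split=> // Y Yd].
apply/negP=> Yi; have [/set0Pn[p pY] YS] := Xs Y Yd Yi.
by have := YS p; rewrite inE pY => /(_ isT).
Qed.

Definition stuck d X := forall Y, #|Y| <= d -> ~~ improves (symd X Y) #|X|.+1.

(** Recording that a successful round started from a candidate that was not stuck makes stuckness
    permanent. *)
Lemma roundP d env m X F T : env 0 = n -> rep X F T m ->
  exists X' F' T', rep X' F' T' (sem (c_round d) env m) /\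
    ([/\ invalid X' = 0, #|X| < #|X'| & ~ stuck d X] \/ X' = X /\ stuck d X).
Proof.
move=> e0 Xm; pose m1 := sem (CWrite e_target (EAdd e_size (EConst 1))) env m.
have Xm1 : rep X F #|X|.+1 m1.
  rewrite (_ : m1 = upd m (n * n + n * n + 1) #|X|.+1); first exact: rep_set_target Xm.
  by rewrite /m1 -(eval_target m e0) -[#|X|.+1]addn1 -(eval_size e0 Xm).
rewrite -[sem _ _ _]/(sem (c_search d) env m1).
case: (searchP d e0 Xm1) => [[Y [Yd Yi Yr]]|[Xr Xs]].
  exists (symd X Y), 1, #|X|.+1; split=> //; left; split.
  - by move: Yi; rewrite /improves addn_eq0 => /andP[/eqP].
  - by move: Yi; rewrite /improves addn_eq0 subn_eq0 => /andP[].
  - by move=> /(_ Y Yd); rewrite Yi.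
by exists X, 0, #|X|.+1; split=> //; right.
Qed.

Lemma mainP d env m F T : env 0 = n -> rep set0 F T m ->
  exists X, [/\ invalid X = 0, stuck d X
    & forall p, sem (c_main d) env m (code p) = (p \in X)].
Proof.
move=> e0 Xm.
have inv0 : invalid set0 = 0.
  by rewrite /invalid !big1 // => i _; rewrite ?big1 // => j _; rewrite ?big1 // => *; rewrite !inE.
(* While no round has failed, the candidate has at least as many pairs as rounds were made. *)
pose I S m' := exists X F T, [/\ rep X F T m', invalid X = 0
  & #|S| <= #|X| \/ stuck d X].
have : I setT (sem (c_pairs (c_round d)) env m).
  apply: sem_pairs => // [S p m' [X [F1 [T1 [Xr Xi Xs]]]]|]; last first.
    by exists set0, F, T; split=> //; left; rewrite cards0.
  set env' := upd _ 2 _; have e0' : env' 0 = n by [].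
  have [X' [F' [T' [Xr' [[Xi' XX' ns]|[e st]]]]]] := roundP d e0' Xr.
    exists X', F', T'; split=> //; left; case: Xs => // SX.
    rewrite cardsU1; apply: leq_trans XX'; case: (p \in S) => //=.
    by rewrite add0n; apply: leqW.
  by subst X'; exists X, F', T'; split=> //; right.
set m1 := sem _ _ _ => -[X [F1 [T1 [Xr Xi Xs]]]].
rewrite -[sem _ _ _]/(sem (c_pairs (CWrite (e_idx 1 2) (e_cell 1 2))) env
                        (sem (c_round d) env m1)).
have [X' [F' [T' [Xr' Xc]]]] := roundP d e0 Xr.
have [Xi' st] : invalid X' = 0 /\ stuck d X'.
  case: Xc => [[Xi' XX' ns]|[-> st]]; last by [].
  case: Xs => // SX.
  (* After one round per pair, a further success would give more pairs than exist. *)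
  by have := leq_ltn_trans SX XX'; rewrite cardsT ltnNge max_card.
exists X'; split=> //; set m2 := sem (c_round d) env m1 in Xr' *.
pose J S m' := (forall p, p \in S -> m' (code p) = (p \in X')) /\
  (forall p, m' (n * n + code p) = (p \in X')).
have : J setT (sem (c_pairs (CWrite (e_idx 1 2) (e_cell 1 2))) env m2).
  apply: sem_pairs => // [S p m' [h1 h2]|]; last first.
    by split=> [p|p]; [rewrite inE | rewrite (rep_cell Xr')].
  set env' := upd _ 2 _; have e0' : env' 0 = n by [].
  rewrite [sem _ _ _](_ : _ = upd m' (code p) (p \in X')); last first.
    rewrite -(@eval_idx env' m' 1 2 p) // -(h2 p).
    by rewrite -(@eval_addr env' m' 1 2 p).
  split=> q.
    case/setU1P=> [->|qS]; first by rewrite upd_same.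
    have [->|qp] := eqVneq q p; first by rewrite upd_same.
    by rewrite upd_other ?h1 // (inj_eq code_inj).
  by rewrite upd_other ?h2 //; apply/eqP; have := code_lt p; lia.
by case=> h _ p; apply: h; rewrite inE.
Qed.

End Program.

(** * The approximation guarantee *)

Section Matrices.
Variable n : nat.
Implicit Types (E M D : {set {set 'I_n}}) (X : {set 'I_n * 'I_n}).

Definition darts M : {set 'I_n * 'I_n} := [set p | adj M p.1 p.2].

Lemma in_darts M i j : ((i, j) \in darts M) = adj M i j.
Proof. by rewrite inE. Qed.

Lemma darts_symd M D : darts (symd M D) = symd (darts M) (darts D).
Proof. by apply/setP=> -[i j]; rewrite in_symd !in_darts /adj in_symd. Qed.

Lemma invalid_darts E M : simple_graph E -> tf2_matching E M ->
  invalid (darts E) (darts M) = 0.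
Proof.
move=> sE /andP[/(two_matchingP _ sE)[ME dM] /no_triangleP nM].
have {}nM := nM (simple_sub sE ME).
rewrite /invalid big1 => [|i _]; last first.
  rewrite big1 // => j _; rewrite !in_darts.
  by case Mij: (adj M i j) => //=; rewrite /adj (subsetP ME _ Mij).
rewrite big1 => [|i _]; last first.
  by rewrite big1 // => j _; rewrite !in_darts adj_sym subnn.
rewrite big1 => [|i _]; last first.
  apply/eqP; rewrite subn_eq0; under eq_bigr do rewrite in_darts.
  rewrite -(card_set_sum (adj M i)); apply/card_le2P => x y z.
  by rewrite !inE; apply: dM.
rewrite big1 // => i _; rewrite big1 // => j _; rewrite big1 // => k _.
rewrite !in_darts; have := nM i j k.
by case: (adj M i j); case: (adj M j k); case: (adj M i k) => // /(_ isT isT isT).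
Qed.

(** Symmetry of [X] is what allows each unordered pair to be read off as an edge. *)
Lemma invalid0_darts E X : simple_graph E -> invalid (darts E) X = 0 ->
  exists2 M, tf2_matching E M & X = darts M.
Proof.
move=> sE /eqP; rewrite /invalid !addn_eq0 -!andbA.
have sum0 (F : 'I_n -> nat) : \sum_i F i == 0 -> forall i, F i = 0.
  by rewrite sum_nat_eq0 => /forallP h i; apply/eqP/h.
case/and4P=> /sum0 XE /sum0 Xs /sum0 Xd /sum0 Xt.
have XsubE i j : (i, j) \in X -> adj E i j.
  have /eqP/sum0/(_ j) := XE i; rewrite in_darts.
  by case: (_ \in X); case: (adj E i j).
have Xsym i j : (i, j) \in X -> (j, i) \in X.
  by have /eqP/sum0/(_ j) := Xs i; case: ((i, j) \in X); case: ((j, i) \in X).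
pose M := [set [set p.1; p.2] | p in X].
have XM : X = darts M.
  apply/setP=> -[i j]; rewrite in_darts; apply/idP/imsetP=> [h|]; first by exists (i, j).
  case=> -[x y] xyX /eqP; rewrite eq_set2 /=.
  by case/orP=> /andP[/eqP-> /eqP->] //; apply: Xsym.
have aM i j : adj M i j = ((i, j) \in X) by rewrite XM in_darts.
exists M => //; have ME : M \subset E.
  by apply/subsetP=> _ /imsetP[[x y] xyX ->]; apply: XsubE.
apply/andP; split.
  apply/two_matchingP=> //; split=> // v x y z; rewrite !aM => hx hy hz.
  suff /card_le2P h : #|[set j | (v, j) \in X]| <= 2 by apply: h; rewrite inE.
  by rewrite card_set_sum -subn_eq0; apply/eqP/Xd.
apply/no_triangleP; first exact: simple_sub ME.
move=> x y z; rewrite !aM => xy yz xz.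
by have /eqP/sum0/(_ y)/eqP/sum0/(_ z) := Xt x; rewrite xy yz xz.
Qed.

(** Exchanging an edge flips its two darts, hence the doubled search depth. *)
Lemma stuck_darts E M k : simple_graph E -> tf2_matching E M ->
  stuck (darts E) (2 * k) (darts M) ->
  forall D, D \subset E -> #|D| <= k -> tf2_matching E (symd M D) ->
  #|symd M D| <= #|M|.
Proof.
move=> sE tM st D DE Dk tMD; rewrite leqNgt; apply/negP=> lt.
have [[ME _] [MDE _]] := (two_matchingP M sE (proj1 (andP tM)),
  two_matchingP _ sE (proj1 (andP tMD))).
have := st (darts D); rewrite /improves -darts_symd invalid_darts //.
rewrite !card_darts; try exact: simple_sub sE _.
by rewrite leq_mul2l Dk orbT => /(_ isT); rewrite subn_eq0 ltn_mul2l lt.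
Qed.

Lemma rep_input E : simple_graph E ->
  rep (darts E) set0 0 0 (Defs.mem (input_state E)).
Proof.
move=> sE; split=> [[i j]|p||].
- rewrite in_darts /=; congr (nat_of_bool _).
  apply/existsP/idP=> [[x /existsP[y /andP[/eqP e xyE]]]|h].
    by have [-> ->] := @code_inj n (i, j) (x, y) e.
  by exists i; apply/existsP; exists j; rewrite eqxx.
all: rewrite ?inE /=; apply/eqP; rewrite eqb0; apply/negP.
all: move=> /existsP[x /existsP[y /andP[/eqP e _]]].
all: have := code_lt (x, y); rewrite /code /= in e *; lia.
Qed.

End Matrices.

Import Order.TTheory GRing.Theory Num.Theory.
Local Open Scope ring_scope.

Theorem theorem1 (R : realType) (eps : R) (heps : 0 < eps <= 1) :
  exists (A : prog) (p : {poly nat}),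
    forall (n : nat) (E : {set {set 'I_n}}), simple_graph E ->
      exists (s : state) (t : nat) (M : {set {set 'I_n}}),
        [/\ exec A (input_state E) s t,
            (t <= p.[n])%N,
            outputs s M,
            tf2_matching E M
          & forall Mstar : {set {set 'I_n}}, max_tf2_matching E Mstar ->
              (1 - eps) * #|Mstar|%:R <= #|M|%:R].
Proof.
case/andP: heps => eps0 _.
pose k := Num.bound (eps^-1).
have k_eps : 1 <= eps * k%:R.
  rewrite -[X in X <= _](mulfV (lt0r_neq0 eps0)) ler_pM2l //.
  by have /archi_boundP/ltW : 0 <= eps^-1 by rewrite invr_ge0 ltW.
(* Exchanges of [2 * k] edges, each made of two ordered pairs. *)
pose c := c_main (2 * (2 * k))%N.
have [p costE] := cost_poly c.
(* Initially every variable denotes register 0, which holds [n]; scratch space starts at register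
   1. *)
exists (compile c (fun=> 0%N) 1), p => n E sE.
have regs (v : nat) : (reg (input_state E) 0 <= n)%N by exact: leqnn.
have [s [[t tp ex] _ ms]] :=
  compileP (ctx := fun=> 0%N) c (fun=> isT : (0 < 1)%N) regs.
have [X [Xi st Xm]] := mainP (2 * (2 * k))%N (erefl n) (rep_input sE)
  (env := fun=> n).
have [M tM XM] := invalid0_darts sE Xi; subst X.
exists s, t, M; split=> //.
- by rewrite -costE.
- by move=> i j; rewrite ms (Xm (i, j)) in_darts.
move=> Ms maxMs.
have := local_optimum (k := k) sE tM (stuck_darts sE tM st) maxMs.
rewrite -(ler_nat R) natrD !natrM => h.
have k0 : 0 < k%:R :> R.
  by rewrite -(pmulr_rgt0 _ eps0); apply: lt_le_trans k_eps.
(* After multiplication by [k], the error term [|Ms|] is absorbed by [eps * k * |Ms|]. *)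
rewrite -(ler_pM2l k0) mulrA mulrBr mulr1 mulrBl lerBlDr.
apply: le_trans h _; rewrite lerD2l [k%:R * eps]mulrC.
exact: ler_peMl.
Qed.
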